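(* Every polynomial $D(-4;4)$-quadruple in $\mathbb{Z}[X]$ is regular. More precisely, let $\{a,b,c\}$ be a $D(-4)$-triple in $\mathbb{Z}[X]$ and let $r',s',t'\in\mathbb{Z}[X]$ satisfy $(r')^2=ab-4$, $(s')^2=ac-4$ and $(t')^2=bc-4$. If $d\in\mathbb{Z}[X]$ is such that $\{a,b,c,d\}$ is a $D(-4;4)$-quadruple in $\mathbb{Z}[X]$, then $$d=d_{\pm}=-(a+b+c)+\frac{1}{2}(abc\pm r's't')$$ for one of the two choices of sign.
   Context: A $D(-4)$-triple in $\mathbb{Z}[X]$ is a set $\{a,b,c\}$ of three distinct non-zero polynomials in $\mathbb{Z}[X]$, not all of them constant, such that $ab-4$, $ac-4$, $bc-4$ are squares of polynomials in $\mathbb{Z}[X]$. A set $\{a,b,c,d\}$ of four non-zero distinct polynomials in $\mathbb{Z}[X]$ is a polynomial $D(-4;4)$-quadruple if $\{a,b,c\}$ is a $D(-4)$-triple in $\mathbb{Z}[X]$ and $ad+4$, $bd+4$, $cd+4$ are all squares of polynomials in $\mathbb{Z}[X]$. Such a quadruple is called regular if $d$ is one of the two polynomials $d_\pm$ displayed in the claim. *)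

(* Defs.v *)
From mathcomp Require Import all_boot all_order all_algebra.

Set Implicit Arguments.
Unset Strict Implicit.
Unset Printing Implicit Defensive.

Import GRing.Theory.
Local Open Scope ring_scope.

(* The inclusion of Z[X] in Q[X]; it is needed because the formula for d_+ and
   d_- contains a factor 1/2. *)
Definition ZtoQ (p : {poly int}) : {poly rat} := map_poly (intr : int -> rat) p.

Definition is_square (p : {poly int}) : Prop := exists q : {poly int}, p = q ^+ 2.

Definition is_constant (p : {poly int}) : Prop := exists k : int, p = k%:P.

Definition Dm4_triple (a b c : {poly int}) : Prop :=
  [/\ uniq [:: a; b; c],
      [/\ a != 0, b != 0 & c != 0],
      ~ [/\ is_constant a, is_constant b & is_constant c]
    & [/\ is_square (a * b - 4), is_square (a * c - 4)
        & is_square (b * c - 4)]].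

(* The order of a, b, c is irrelevant, but d plays a distinguished role. *)
Definition Dm4_4_quadruple (a b c d : {poly int}) : Prop :=
  [/\ uniq [:: a; b; c; d],
      [/\ a != 0, b != 0, c != 0 & d != 0],
      Dm4_triple a b c
    & [/\ is_square (a * d + 4), is_square (b * d + 4)
        & is_square (c * d + 4)]].

Definition d_plus (a b c r s t : {poly int}) : {poly rat} :=
  - ZtoQ (a + b + c) + (1 / 2 : rat) *: ZtoQ (a * b * c + r * s * t).

Definition d_minus (a b c r s t : {poly int}) : {poly rat} :=
  - ZtoQ (a + b + c) + (1 / 2 : rat) *: ZtoQ (a * b * c - r * s * t).

(* The square roots r, s, t are determined up to sign, and changing a sign at
   most exchanges d_plus and d_minus, so their choice is irrelevant. *)
Definition regular (a b c d : {poly int}) : Prop :=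
  exists r s t : {poly int},
    [/\ r ^+ 2 = a * b - 4, s ^+ 2 = a * c - 4, t ^+ 2 = b * c - 4
      & ZtoQ d = d_plus a b c r s t \/ ZtoQ d = d_minus a b c r s t].

(* Main.v *)
(** Multiplying [a], [b], [c] by [i/2] and [d] by [-i/2] turns the quadruple into four polynomials
    over Q(i) whose pairwise products plus 1 are squares, and regularity becomes the symmetric
    relation [(a+b-c-d)^2 = 4(ab+1)(cd+1)].  Order them by degree.  The squares [ad+1] and [cd+1]
    give a solution of the Pell equation [a z^2 - c x^2 = a - c]; multiplying by [s - sqrt(ac)],
    where [s^2 = ac+1], descends from [d] through a chain of polynomials whose degrees drop by
    [deg a + deg c].  The chain is a quadratic progression modulo [c], so comparing it with the
    chain of the pair [(b, c)] yields a congruence modulo [c] between polynomials of smaller degree,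
    that is, an equality.  The bottoms of the two chains are identified by comparing [z] modulo [c]
    and by induction on the sum of the degrees, and a comparison of degrees then leaves only the
    regular [d].  Arithmetic enters only through constants: if [a] is constant, [2a] is integral and
    [a^2 + 1] is a square in Q(i), then [a = 0] or [a^2 = -1].  Over the complex numbers this fails,
    and so does the theorem ([a^2 = -3/4]). *)

(* The congruence modulo [c] is useful only once both bottoms are known. A bottom [(u, v)] on
   [(a, c)] with [deg a < deg c] has [u = 0], or [u = a] with [a^2 = -1], or is far:
   [deg u + deg v = deg c - deg a]. Two far bottoms share an entry [f] with [deg f < deg c], and the
   smaller quadruple [{a, b, c, f}] is where the induction enters. If [deg b = deg c], then [b] is
   not reduced modulo [c]; but in that case [c = a + b + 2 r] with [r^2 = ab + 1], or [c = 2 a - b]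
   with [a^2 = -1]. The condition on [2a] comes from the factor [i/2]. Division by 2 leaves Z[i],
   yet integrality of doubled values survives the descent, since in doubled variables regularity is
   a monic quadratic equation in each argument. For a constant [a] with [a^2 + 1] a square,
   [w = a + sqrt(a^2 + 1)] is then a unit with inverse [w - 2 a]. The value [a^2 = -1] cannot be
   discarded: it comes from the constants 2 and -2, and it is the source of the exceptional
   cases. *)
Require Import Defs.
From HB Require Import structures.
From mathcomp Require Import all_boot all_order all_algebra all_field.
From mathcomp Require Import zify ring complex.

Set Implicit Arguments.
Unset Strict Implicit.
Unset Printing Implicit Defensive.
Import Order.TTheory GRing.Theory Num.Theory.
Local Open Scope ring_scope.

(** * Degrees *)

(* The zero polynomial has degree 0 here. *)
Definition deg (R : nzSemiRingType) (p : {poly R}) : nat := (size p).-1.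
Arguments deg {R} p%_R.

Section Degree.
Variable K : fieldType.
Hypothesis K0 : [pchar K] =i pred0.
Implicit Types a b c d e p q r s t u v x y z : {poly K}.

Lemma natr_neq0 (n : nat) : (n != 0)%N -> n%:R != 0 :> K.
Proof. by move/pcharf0P: K0 => ->. Qed.

Lemma intr_neq0 (n : int) : n != 0 -> n%:~R != 0 :> K.
Proof.
case: n => n n0; first by rewrite natr_neq0 //; apply: contraNneq n0 => ->.
by rewrite NegzE mulrNz oppr_eq0 natr_neq0.
Qed.

Lemma intr_inj0 (n : int) : n%:~R = 0 :> K -> n = 0.
Proof. by move/eqP; apply: contraTeq => /intr_neq0. Qed.

Lemma size_gt0E p : p != 0 -> size p = (deg p).+1.
Proof. by rewrite -size_poly_gt0 /deg; case: (size p). Qed.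

Lemma deg0 : deg (0 : {poly K}) = 0%N.
Proof. by rewrite /deg size_poly0. Qed.

Lemma degC (k : K) : deg k%:P = 0%N.
Proof. by rewrite /deg size_polyC; case: eqP. Qed.

Lemma deg1 : deg (1 : {poly K}) = 0%N.
Proof. exact: degC. Qed.

Lemma deg_nat (n : nat) : deg (n%:R : {poly K}) = 0%N.
Proof. by rewrite -polyC_natr degC. Qed.

Lemma deg_int (n : int) : deg (n%:~R : {poly K}) = 0%N.
Proof. by rewrite -[n%:~R](rmorph_int polyC) degC. Qed.

Lemma natP_neq0 (n : nat) : (n != 0)%N -> n%:R != 0 :> {poly K}.
Proof. by move=> n0; rewrite -polyC_natr polyC_eq0 natr_neq0. Qed.

Lemma intP_neq0 (n : int) : n != 0 -> n%:~R != 0 :> {poly K}.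
Proof. by move=> n0; rewrite -[n%:~R](rmorph_int polyC) polyC_eq0 intr_neq0. Qed.

Lemma deg_gt0 p : (0 < deg p)%N -> p != 0.
Proof. by apply: contraTneq => ->; rewrite deg0. Qed.

Lemma deg_eq0 p : deg p = 0%N -> exists k, p = k%:P.
Proof.
move=> dp; exists p`_0; apply: size1_polyC.
by move: dp; rewrite /deg; case: (size p) => [|[]].
Qed.

Lemma degM p q : p != 0 -> q != 0 -> deg (p * q) = (deg p + deg q)%N.
Proof.
by move=> p0 q0; rewrite {1}/deg size_mul // !size_gt0E // addnS addSn.
Qed.

Lemma degM_le p q i j : (deg p <= i)%N -> (deg q <= j)%N -> (deg (p * q) <= i + j)%N.
Proof.
move=> pi qj; have [->|p0] := eqVneq p 0; first by rewrite mul0r deg0.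
have [->|q0] := eqVneq q 0; first by rewrite mulr0 deg0.
by rewrite degM // leq_add.
Qed.

Lemma degX2_le p i : (deg p <= i)%N -> (deg (p ^+ 2) <= i + i)%N.
Proof. by rewrite expr2 => h; apply: degM_le. Qed.

Lemma degD_le p q i j : (deg p <= i)%N -> (deg q <= j)%N -> (deg (p + q) <= maxn i j)%N.
Proof.
move: (size_polyD p q); rewrite /deg; lia.
Qed.

Lemma degN p : deg (- p) = deg p.
Proof. by rewrite /deg size_polyN. Qed.

Lemma degN_le p i : (deg p <= i)%N -> (deg (- p) <= i)%N.
Proof. by rewrite degN. Qed.

Lemma degD_eq p q : (deg q < deg p)%N -> deg (p + q) = deg p.
Proof.
by move=> h; rewrite /deg size_polyDl //; move: h; rewrite /deg; lia.
Qed.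

Lemma degX2 p : deg (p ^+ 2) = (2 * deg p)%N.
Proof.
have [->|p0] := eqVneq p 0; first by rewrite expr2 mul0r deg0.
by rewrite expr2 degM // mul2n addnn.
Qed.

Lemma deg_sqrt r a b : r ^+ 2 = a * b + 1 -> a != 0 -> b != 0 ->
  (2 * deg r = deg a + deg b)%N.
Proof.
move=> h a0 b0; rewrite -degX2 h.
have [d|] := posnP (deg a + deg b).
  move: d; rewrite -degM // => /deg_eq0 [k ->].
  by rewrite -polyC1 -polyCD !degC.
by move=> d; rewrite degD_eq ?degM // deg1.
Qed.

Lemma degC_le (k : K) : (@deg K (k%:P : {poly K}) <= 0)%N. Proof. by rewrite degC. Qed.
Lemma deg1_le : (@deg K (1 : {poly K}) <= 0)%N. Proof. by rewrite deg1. Qed.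
Lemma deg0_le : (@deg K (0 : {poly K}) <= 0)%N. Proof. by rewrite deg0. Qed.
Lemma degn_le n : (@deg K (n%:R : {poly K}) <= 0)%N. Proof. by rewrite deg_nat. Qed.
Lemma degz_le n : (@deg K (n%:~R : {poly K}) <= 0)%N. Proof. by rewrite deg_int. Qed.

(** The device that turns a congruence modulo [c] into an equality. *)
Lemma small_mul c p q : (deg p < deg c)%N -> p = c * q -> p = 0 /\ q = 0.
Proof.
move=> h E; have [q0|q0] := eqVneq q 0; first by rewrite E q0 mulr0.
have c0 : c != 0 by apply: deg_gt0; lia.
by move: h; rewrite E degM //; lia.
Qed.


End Degree.

(** Upper bounds only: a sum is bounded by the maximum of the bounds, so cancellation of leading
    terms stays invisible. *)
Ltac degb := lazymatch goal with
  | |- is_true (leq (deg (_ + _)) _) => eapply degD_le; [degb | degb]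
  | |- is_true (leq (deg (_ * _)) _) => eapply degM_le; [degb | degb]
  | |- is_true (leq (deg (_ ^+ 2)) _) => eapply degX2_le; degb
  | |- is_true (leq (deg (- _)) _) => eapply degN_le; degb
  | |- is_true (leq (deg (polyC _)) _) => eapply degC_le
  | |- is_true (leq (deg 1) _) => eapply deg1_le
  | |- is_true (leq (deg 0) _) => eapply deg0_le
  | |- is_true (leq (deg (1 *+ _)) _) => eapply degn_le
  | |- is_true (leq (deg (1 *~ _)) _) => eapply degz_le
  | |- _ => exact: leqnn
  end.
Ltac clear_all_but_nat := repeat match goal with
  | H : ?T |- _ => lazymatch T with
    | is_true (leq _ _) => fail
    | @eq ?A _ _ => tryif unify A nat then fail else clear H
    | _ => clear H
    end
  end.
Ltac dlia := solve [clear_all_but_nat; lia].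
Ltac degbound := first [eapply leq_ltn_trans; [degb | dlia] | eapply leq_trans; [degb | dlia]].

(** * Conics with constant coefficients *)

Section Conic.
Variable K : fieldType.
Hypothesis K0 : [pchar K] =i pred0.
Implicit Types a b c d e p q r s t u v x y z : {poly K}.

Lemma two_neq0 : 2%:R != 0 :> {poly K}.
Proof. exact: natP_neq0. Qed.

(** Comparing leading coefficients gives [A = B rho^2], so the left side factors as
    [B (rho x - y) (rho x + y)]. If [C] were nonzero, both factors would be constant, and so would
    their sum [2 rho x]. *)
Lemma const_conic (A B C : K) x y : A%:P * x ^+ 2 - B%:P * y ^+ 2 = C%:P ->
  A != 0 -> B != 0 -> (0 < deg x)%N -> C = 0.
Proof.
move=> E A0 B0 dx.
have EA : A%:P * x ^+ 2 = B%:P * y ^+ 2 + C%:P by rewrite -E; ring.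
have x0 := deg_gt0 dx.
have dAx : deg (A%:P * x ^+ 2) = (2 * deg x)%N.
  by rewrite degM ?degC ?degX2 ?polyC_eq0 ?sqrf_eq0.
have dy : (0 < deg y)%N.
  rewrite lt0n; apply/eqP => dy.
  have : (deg (B%:P * y ^+ 2 + C%:P)%R <= 0)%N by degbound.
  by rewrite -EA dAx; lia.
have y0 := deg_gt0 dy.
have lE : A * lead_coef x ^+ 2 = B * lead_coef y ^+ 2.
  have := congr1 lead_coef EA.
  rewrite lead_coefDl ?lead_coefM ?lead_coefC ?expr2 ?lead_coefM //.
  have By0 : B%:P * (y * y) != 0 by rewrite !mulf_neq0 ?polyC_eq0.
  rewrite (size_gt0E By0) (leq_ltn_trans (size_polyC_leq1 _)) //.
  by rewrite !degM ?degC ?polyC_eq0 ?mulf_neq0 //; lia.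
have lx0 : lead_coef x != 0 by rewrite lead_coef_eq0.
have ly0 : lead_coef y != 0 by rewrite lead_coef_eq0.
have [rho Arho] : exists rho, A = B * rho ^+ 2.
  exists (lead_coef y / lead_coef x).
  by apply: (mulIf (expf_neq0 2 lx0)); rewrite lE; field.
have rho0 : rho != 0 by apply: contraNneq A0 => r0; rewrite Arho r0 expr2 !mul0r mulr0.
have F : B%:P * ((rho%:P * x - y) * (rho%:P * x + y)) = C%:P.
  by rewrite -E Arho polyCM polyC_exp; ring.
apply/eqP; apply: contraT => C0.
have /andP[n1 n2] : (rho%:P * x - y != 0) && (rho%:P * x + y != 0).
  rewrite -negb_or -mulf_eq0; apply: contraNneq C0 => Z.
  by rewrite -polyC_eq0 -F Z mulr0.
have := congr1 (@deg K) F; rewrite !degM ?mulf_neq0 ?polyC_eq0 // !degC => D.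
have : (deg ((rho%:P * x - y) + (rho%:P * x + y))%R <= 0)%N.
  by apply: leq_trans (degD_le (leqnn _) (leqnn _)) _; lia.
have -> : (rho%:P * x - y) + (rho%:P * x + y) = (2 * rho)%:P * x.
  by rewrite polyCM polyC_natr; ring.
have r0 : 2 * rho != 0 by rewrite mulf_neq0 ?natr_neq0.
by rewrite degM ?degC ?polyC_eq0 //; lia.
Qed.

(** Eliminating [c] gives the conic [a s^2 - b r^2 = a - b]. *)
Lemma two_consts a b c r s : r ^+ 2 = a * c + 1 -> s ^+ 2 = b * c + 1 ->
  a != 0 -> b != 0 -> deg a = 0%N -> deg b = 0%N -> (0 < deg c)%N -> a = b.
Proof.
move=> Er Es a0 b0 /deg_eq0[A aE] /deg_eq0[B bE] dc; subst a b.
have c0 := deg_gt0 dc.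
have ds := deg_sqrt Es b0 c0; rewrite degC in ds.
have E : A%:P * s ^+ 2 - B%:P * r ^+ 2 = (A - B)%:P.
  by rewrite Es Er polyCB; ring.
rewrite !polyC_eq0 in a0 b0.
have dsp : (0 < deg s)%N by lia.
by have /eqP := const_conic E a0 b0 dsp; rewrite subr_eq0 => /eqP->.
Qed.

Lemma const_mul_square p (k : K) x : x ^+ 2 = k%:P * p ^+ 2 + 1 -> k != 0 -> deg p = 0%N.
Proof.
move=> E k0; apply/eqP; apply: contraT; rewrite -lt0n => dp.
have /eqP : (1 : K) = 0; last by rewrite oner_eq0.
apply: (@const_conic 1 k 1 x p); rewrite ?oner_eq0 // ?E; first by rewrite polyC1; ring.
have p0 := deg_gt0 dp.
have kp0 : k%:P * p != 0 by rewrite mulf_neq0 ?polyC_eq0.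
have E' : x ^+ 2 = k%:P * p * p + 1 by rewrite E; ring.
have := deg_sqrt E' kp0 p0; rewrite degM ?degC ?polyC_eq0 //; lia.
Qed.

Lemma self_square p x : x ^+ 2 = p * p + 1 -> deg p = 0%N.
Proof.
by move=> E; apply: (@const_mul_square p 1 x); rewrite ?oner_eq0 // E polyC1; ring.
Qed.

End Conic.

(** * Regularity *)

(* Symmetric in the four arguments; solved for [d] it reads [d = a + b + c + 2abc + 2w] with
   [w^2 = (ab+1)(ac+1)(bc+1)]. *)
Definition reg (R : comNzRingType) (a b c d : R) : Prop :=
  (a + b - c - d) ^+ 2 = 4 * (a * b + 1) * (c * d + 1).

Section Reg.
Variable R : comNzRingType.
Implicit Types a b c d : R.

Lemma regE a b c d : reg a b c d <->
  a ^+ 2 + b ^+ 2 + c ^+ 2 + d ^+ 2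
  = 2 * (a * b + a * c + a * d + b * c + b * d + c * d) + 4 * a * b * c * d + 4.
Proof.
rewrite /reg; split=> E.
  transitivity ((a + b - c - d) ^+ 2
    + 2 * (a * c + a * d + b * c + b * d - a * b - c * d)); first by ring.
  by rewrite E; ring.
transitivity (a ^+ 2 + b ^+ 2 + c ^+ 2 + d ^+ 2
  + 2 * (a * b + c * d - a * c - a * d - b * c - b * d)); first by ring.
by rewrite E; ring.
Qed.

Lemma reg_swap12 a b c d : reg a b c d -> reg b a c d.
Proof.
move/regE => E; apply/regE.
transitivity (a ^+ 2 + b ^+ 2 + c ^+ 2 + d ^+ 2); first by ring.
by rewrite E; ring.
Qed.

Lemma reg_swap23 a b c d : reg a b c d -> reg a c b d.
Proof.
move/regE => E; apply/regE.
transitivity (a ^+ 2 + b ^+ 2 + c ^+ 2 + d ^+ 2); first by ring.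
by rewrite E; ring.
Qed.

Lemma reg_swap34 a b c d : reg a b c d -> reg a b d c.
Proof.
move/regE => E; apply/regE.
transitivity (a ^+ 2 + b ^+ 2 + c ^+ 2 + d ^+ 2); first by ring.
by rewrite E; ring.
Qed.


Lemma regP a b c w d : w ^+ 2 = (a * b + 1) * (a * c + 1) * (b * c + 1) ->
  d = a + b + c + 2 * a * b * c + 2 * w -> reg a b c d.
Proof. by move=> E ->; apply/regE; ring: E. Qed.

End Reg.

(** Regularity is a monic quadratic equation in its last argument; distinct [p] and [q] are its two
    roots, and Vieta gives their sum. *)
Lemma reg_uniq (R : idomainType) (a b c p q : R) : reg a b c p -> reg a b c q ->
  p = q \/ p + q = 2 * (a + b + c + 2 * a * b * c).
Proof.
move=> /regE E1 /regE E2.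
have /eqP : (p - q) * (p + q - 2 * (a + b + c + 2 * a * b * c)) = 0.
  transitivity ((a ^+ 2 + b ^+ 2 + c ^+ 2 + p ^+ 2) - (a ^+ 2 + b ^+ 2 + c ^+ 2 + q ^+ 2)
    - 2 * (a + b + c) * (p - q) - 4 * a * b * c * (p - q)); first by ring.
  by rewrite E1 E2; ring.
rewrite mulf_eq0 => /orP[] /eqP H; [left|right]; apply/eqP; rewrite -subr_eq0 H //.
Qed.

(** * Degrees of the two regular completions of a triple *)

Section UpDown.
Variable K : fieldType.
Hypothesis K0 : [pchar K] =i pred0.
Implicit Types a b c d e p q r s t u v x y z w : {poly K}.

Lemma deg_triple_sum a b c : (0 < deg a + deg b)%N -> (deg a <= deg c)%N -> (deg b <= deg c)%N ->
  a != 0 -> b != 0 -> c != 0 ->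
  deg (a + b + c + 2 * a * b * c) = (deg a + deg b + deg c)%N.
Proof.
move=> ab ac bc a0 b0 c0.
have d2 : deg (2 * a * b * c) = (deg a + deg b + deg c)%N.
  by rewrite !degM ?mulf_neq0 ?(two_neq0 K0) // deg_nat.
rewrite addrC degD_eq d2 //.
have : (deg (a + b + c) <= deg c)%N by degbound.
by lia.
Qed.

Lemma deg_up_down a b c p q : (0 < deg a + deg b)%N -> (deg a <= deg c)%N -> (deg b <= deg c)%N ->
  a != 0 -> b != 0 -> c != 0 ->
  p + q = 2 * (a + b + c + 2 * a * b * c) ->
  (deg q < deg a + deg b + deg c)%N -> deg p = (deg a + deg b + deg c)%N.
Proof.
move=> ab ac bc a0 b0 c0 E dq.
have D := deg_triple_sum ab ac bc a0 b0 c0.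
have S0 : a + b + c + 2 * a * b * c != 0 by apply: deg_gt0; lia.
have -> : p = 2 * (a + b + c + 2 * a * b * c) - q by rewrite -E; ring.
by rewrite degD_eq degM ?(two_neq0 K0) // deg_nat ?degN D.
Qed.

(** The values for [r] and [- r] add up to [2 (a + b + c + 2abc)], which has the full degree, so at
    least one of them attains it. *)
Lemma up_exists a b c r s t : (0 < deg a + deg b)%N -> (deg a <= deg c)%N -> (deg b <= deg c)%N ->
  a != 0 -> b != 0 -> c != 0 ->
  r ^+ 2 = a * b + 1 -> s ^+ 2 = a * c + 1 -> t ^+ 2 = b * c + 1 ->
  exists2 r', r' = r \/ r' = - r &
    deg (a + b + c + 2 * a * b * c + 2 * r' * s * t) = (deg a + deg b + deg c)%N.
Proof.
move=> ab ac bc a0 b0 c0 Er Es Et.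
have D := deg_triple_sum ab ac bc a0 b0 c0.
have dr := deg_sqrt Er a0 b0; have ds := deg_sqrt Es a0 c0; have dt := deg_sqrt Et b0 c0.
set S := a + b + c + _ in D *.
have dw (r' : {poly K}) : deg r' = deg r ->
    (deg (S + 2 * r' * s * t) <= deg a + deg b + deg c)%N.
  by move=> dr'; degbound.
have [h|h] := eqVneq (deg (S + 2 * r * s * t)) (deg a + deg b + deg c)%N.
  by exists r; first left.
exists (- r); first by right.
have S0 : S != 0 by apply: deg_gt0; lia.
have -> : S + 2 * - r * s * t = 2 * S - (S + 2 * r * s * t) by ring.
have := dw r erefl; move/eqP: h => h h1.
by rewrite degD_eq degM ?(two_neq0 K0) // deg_nat ?degN D //; lia.
Qed.

End UpDown.

(** * Descent along a pair *)

Section Chain.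
Variable K : fieldType.
Hypothesis K0 : [pchar K] =i pred0.
Implicit Types a b c d e p q r s t u v x y z w : {poly K}.

(* A state [(z, x, p)] on the pair [(a, c)] is a polynomial [p] with square roots [z] of [cp+1]
   and [x] of [ap+1]; [step e] multiplies [z sqrt a + x sqrt c] by [s + e sqrt (ac)]. *)
Definition state : Type := {poly K} * {poly K} * {poly K}.

Section Orbit.
Variables a c s : {poly K}.

Definition step (e : {poly K}) (st : state) : state :=
  let: (z, x, p) := st in
  (s * z + e * c * x, s * x + e * a * z,
   a + c + p + 2 * a * c * p + 2 * e * s * x * z).

Definition on_pair (st : state) : Prop :=
  let: (z, x, p) := st in z ^+ 2 = c * p + 1 /\ x ^+ 2 = a * p + 1.

Hypothesis Es : s ^+ 2 = a * c + 1.

Lemma step_on_pair e st : e ^+ 2 = 1 -> on_pair st -> on_pair (step e st).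
Proof.
by case: st => [[z x] p] /= Ee [Ez Ex]; split; ring: Es Ez Ex Ee.
Qed.

Lemma stepK e st : e ^+ 2 = 1 -> on_pair st -> step e (step (- e) st) = st.
Proof.
case: st => [[z x] p] /= Ee [Ez Ex]; congr (_, _, _); ring: Es Ez Ex Ee.
Qed.

Lemma step_upK st : on_pair st -> step (-1) (step 1 st) = st.
Proof. by move=> pst; rewrite -{2}[1]opprK stepK // sqrrN expr1n. Qed.

Lemma step_sum st :
  (step 1 st).2 + (step (-1) st).2 = 2 * (a + c + st.2 + 2 * a * c * st.2).
Proof. by case: st => [[z x] p] /=; ring. Qed.

(** Vieta again: the constant term of the quadratic that [reg a c st.2] imposes on both neighbours.
    Knowing the degree of one neighbour bounds the other. *)
Lemma step_prod st : on_pair st ->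
  (step 1 st).2 * (step (-1) st).2 = (a + c - st.2) ^+ 2 - 4 * (a * c + 1).
Proof. by case: st => [[z x] p] /= [Ez Ex]; ring: Es Ez Ex. Qed.

Lemma step_reg e st : e ^+ 2 = 1 -> on_pair st -> reg a c st.2 (step e st).2.
Proof.
by case: st => [[z x] p] /= Ee [Ez Ex]; apply/regE; ring: Es Ez Ex Ee.
Qed.

Hypothesis a0 : a != 0.
Hypothesis dc : (0 < deg c)%N.
Hypothesis dac : (deg a <= deg c)%N.

(** While an entry [p] has degree at least [deg c], its neighbours have a product of degree at most
    [2 deg p]; the upper one exceeds [p], so the lower one is smaller again. *)
Lemma descent n st : (deg st.2 <= n)%N -> on_pair st ->
  (deg c <= deg st.2)%N -> (deg (step (-1) st).2 < deg st.2)%N ->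
  exists m st0, [/\ on_pair st0, st = iter m.+1 (step 1) st0,
    (deg st0.2 < deg c)%N & (deg c <= deg (step 1 st0).2)%N].
Proof.
elim: n st => [|n IH] st dn pst dst dd; first by move: dst dn; lia.
have upK : step 1 (step (-1) st) = st by rewrite stepK // expr1n.
have pd : on_pair (step (-1) st) by apply: step_on_pair => //; rewrite sqrrN expr1n.
have [h|h] := ltnP (deg (step (-1) st).2) (deg c).
  by exists 0%N, (step (-1) st); rewrite /= upK; split.
have [||||m [st0 [h1 h2 h3 h4]]] := IH (step (-1) st); rewrite ?upK //; first by lia.
  have := step_prod pd; rewrite upK => /(congr1 (@deg K)).
  set p := (step (-1) st).2 in h dd *; set p' := (step (-1) _).2.
  rewrite ltnNge => E; apply/negP => pp'.
  have : (deg ((a + c - p) ^+ 2 - 4 * (a * c + 1)) <= deg p + deg p)%N.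
    by degbound.
  by rewrite -E degM ?deg_gt0 //; lia.
by exists m.+1, st0; split; rewrite // iterS -h2 upK.
Qed.

Let P st j := (iter j (step 1) st).2.

Lemma orbit_on_pair st j : on_pair st -> on_pair (iter j (step 1) st).
Proof. by move=> pst; elim: j => //= j IH; apply: step_on_pair; rewrite ?expr1n. Qed.

Lemma orbit_rec st j : on_pair st ->
  P st j.+2 + P st j = 2 * (a + c + P st j.+1 + 2 * a * c * P st j.+1).
Proof.
move=> /(orbit_on_pair j) pst; rewrite /P -step_sum; congr (_ + _.2).
by rewrite [iter j.+1 _ _]iterS step_upK.
Qed.

(** Modulo [c] the recurrence says that the second differences equal [2 a]; the values at the
    indices -1 and 0 fix the quadratic. *)
Lemma orbit_mod st j : on_pair st -> exists q,
  P st j = j.+1%:R * st.2 - j%:R * (step (-1) st).2 + a * (j%:R * j.+1%:R) + c * q.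
Proof.
move=> pst.
suff [] : (exists q,
  P st j = j.+1%:R * st.2 - j%:R * (step (-1) st).2 + a * (j%:R * j.+1%:R) + c * q) /\
  (exists q,
  P st j.+1 = j.+2%:R * st.2 - j.+1%:R * (step (-1) st).2 + a * (j.+1%:R * j.+2%:R) + c * q) by [].
elim: j => [|j [[q1 E1] [q2 E2]]].
  split; first by exists 0; rewrite /P /=; ring.
  exists (2 * (1 + 2 * a * st.2)).
  transitivity (((step 1 st).2 + (step (-1) st).2) - (step (-1) st).2); first by rewrite /P /=; ring.
  by rewrite step_sum; ring.
split; first by exists q2.
have R := orbit_rec j pst.
move: E1 E2 R; move: (P st j.+2) (P st j.+1) (P st j) (step _ st).2 st.2 => p2 p1 p v u E0 E1 R.
exists (2 + 2 * q2 - q1 + 4 * a * p1).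
transitivity ((p2 + p) - p); first by ring.
by rewrite R E1 E0; ring.
Qed.

(** Modulo [c] two steps multiply [z] by [s^2], which is congruent to 1, so only the parity of the
    index remains. *)
Lemma orbit_root st j : exists q, (iter j (step 1) st).1.1 =
  (if odd j then (step (-1) st).1.1 else st.1.1) + c * q.
Proof.
suff [] : (exists q, (iter j (step 1) st).1.1 =
  (if odd j then (step (-1) st).1.1 else st.1.1) + c * q) /\
  (exists q, (iter j.+1 (step 1) st).1.1 =
  (if odd j.+1 then (step (-1) st).1.1 else st.1.1) + c * q) by [].
elim: j => [|j [[q1 E1] [q2 E2]]].
  split; first by exists 0; rewrite /=; ring.
  by case: st => [[z x] p] /=; exists (2 * x); ring.
split; first by exists q2.
have E3 st' : (step 1 (step 1 st')).1.1 = st'.1.1 + c * (2 * (step 1 st').1.2).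
  by case: st' => [[z x] p] /=; ring: Es.
exists (q1 + 2 * (iter j.+1 (step 1) st).1.2).
by rewrite !iterS E3 {1}E1 /= negbK; ring.
Qed.
End Orbit.

(* [J] abstracts integrality; [J_unit] is the only arithmetic input of the proof. *)
Section Integral.
Variable J : {poly K} -> Prop.
Hypothesis J_reg : forall a c p q, J a -> J c -> J p -> reg a c p q -> J q.
Hypothesis J_unit : forall a w : K, J a%:P -> w ^+ 2 = 2 * a * w + 1 -> a != 0 -> a ^+ 2 = -1.

Lemma self_pair a w : J a -> a != 0 -> w ^+ 2 = a * a + 1 -> a ^+ 2 = -1 /\ w = 0.
Proof.
move=> Ja a0 E; have /deg_eq0[A aE] := self_square K0 E; subst a.
have /deg_eq0[W wE] : deg w = 0%N by have := deg_sqrt E a0 a0; rewrite degC; lia.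
subst w; move: E; rewrite -polyC1 -polyCM -polyCD -polyC_exp => /polyC_inj E.
have A2 : A ^+ 2 = -1.
  (* The roots of [T^2 - 2 A T - 1] are [A + W] and [A - W], because [A^2 + 1 = W^2]. *)
  by rewrite polyC_eq0 in a0; apply: (J_unit (w := A + W)) => //; ring: E.
split; first by rewrite -polyC_exp A2 polyCN polyC1.
by apply/eqP; rewrite polyC_eq0 -sqrf_eq0 E -expr2 A2 addNr.
Qed.

(* [u] and [v] are the entries of index 0 and -1 of the chain, [2(a+c+u+2acu) - v] is its entry of
   index 1, and [d] its entry of index [m+1]. *)
Record chain a c s z d m Z X u v : Prop := Chain {
  chZ : Z ^+ 2 = c * u + 1;
  chX : X ^+ 2 = a * u + 1;
  chv : v = a + c + u + 2 * a * c * u - 2 * s * X * Z;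
  chu : (deg u < deg c)%N;
  chp : (deg c <= deg (2 * (a + c + u + 2 * a * c * u) - v))%N;
  chd : deg d = (deg (2 * (a + c + u + 2 * a * c * u) - v) + m * (deg a + deg c))%N;
  chm : exists q, d = m.+2%:R * u - m.+1%:R * v + a * (m.+1%:R * m.+2%:R) + c * q;
  chz : exists q, z = (if odd m then Z else s * Z - c * X) + c * q;
  chJu : J u;
  chJv : J v;
  ch0 : m = 0%N -> d = 2 * (a + c + u + 2 * a * c * u) - v;
  ch1 : m = 1%N -> reg a c (2 * (a + c + u + 2 * a * c * u) - v) d }.

(** The sign of [x] is chosen so that stepping up from [d] gains the full degree; by [step_prod],
    stepping down then loses degree and [descent] starts. *)
Lemma chain_exists a c s z x d : s ^+ 2 = a * c + 1 -> z ^+ 2 = c * d + 1 -> x ^+ 2 = a * d + 1 ->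
  a != 0 -> (0 < deg c)%N -> (deg a <= deg c)%N -> (deg c <= deg d)%N -> J a -> J c -> J d ->
  exists m Z X u v, chain a c s z d m Z X u v.
Proof.
move=> Es Ez Ex a0 dc dac dcd Ja Jc Jd.
have c0 := deg_gt0 dc; have d0 : d != 0 by apply: deg_gt0; lia.
have [x' Ex' Dx] : exists2 x', x' = x \/ x' = - x &
    deg (a + c + d + 2 * a * c * d + 2 * s * x' * z) = (deg a + deg c + deg d)%N.
  have [||s' [] ->] := up_exists K0 _ _ dcd a0 c0 d0 Es Ex Ez; try lia.
  - by move=> D; exists x; [left|].
  - by move=> D; exists (- x); [right|rewrite -D; congr deg; ring].
have {}Ex : x' ^+ 2 = a * d + 1 by case: Ex' => ->; rewrite ?sqrrN.
have pst : on_pair a c (z, x', d) by [].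
have Dd : (deg (step a c s (-1) (z, x', d)).2 < deg d)%N.
  have := step_prod Es pst; move/(congr1 (@deg K)).
  have D1 : deg (step a c s 1 (z, x', d)).2 = (deg a + deg c + deg d)%N.
    by rewrite -Dx; congr deg => /=; ring.
  have : (deg ((a + c - d) ^+ 2 - 4 * (a * c + 1)) <= deg d + deg d)%N by degbound.
  set p := (step a c s (-1) _).2; have [->|p0] := eqVneq p 0; first by rewrite deg0; lia.
  have n1 : (step a c s 1 (z, x', d)).2 != 0 by apply: deg_gt0; lia.
  by move=> /= h /esym; rewrite degM // D1; lia.
have [m [[[Z X] u] [pst0 stE du dp]]] := descent Es a0 dc dac (leqnn _) pst dcd Dd.
have P1E st : (step a c s 1 st).2
   = 2 * (a + c + st.2 + 2 * a * c * st.2) - (step a c s (-1) st).2.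
  by rewrite -(step_sum a c s); ring.
have dE : d = (iter m.+1 (step a c s 1) (Z, X, u)).2 by rewrite -stE.
have Jrec st e : e ^+ 2 = 1 -> on_pair a c st -> J st.2 -> J (step a c s e st).2.
  by move=> Ee pe Je; apply: J_reg (step_reg Es Ee pe).
(* Integrality is known at the top [d] and is carried down by the inverse steps. *)
have Ju : J u.
  have : J (z, x', d).2 by [].
  rewrite stE; elim: (m.+1) => [|k IH] //= Jk; apply: IH.
  have pk := orbit_on_pair Es k pst0.
  have := Jrec _ (-1) _ (step_on_pair Es (expr1n _ _) pk) Jk.
  by rewrite step_upK //; apply; rewrite sqrrN expr1n.
exists m, Z, X, u, (step a c s (-1) (Z, X, u)).2.
have P1E' := P1E (Z, X, u); rewrite /= in P1E'.
case: (pst0) => EZ EX; split=> //=.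
- by ring.
- by rewrite -P1E'.
- rewrite -P1E' dE.
  have [Q QE] : exists Q : nat -> {poly K}, forall k, (iter k (step a c s 1) (Z, X, u)).2 = Q k.
    by eexists => k.
  have Qrec k := orbit_rec Es k pst0; rewrite QE.
  have dp1 : deg (step a c s 1 (Z, X, u)).2 = deg (Q 1) by rewrite -QE.
  (* The entries [k] and [k + 2] have a sum of degree [deg a + deg c] above that of entry [k + 1],
     and entry [k] is too small to contribute. *)
  have dQ k : [/\ deg (Q k.+1) = (deg (Q 1%N) + k * (deg a + deg c))%N,
     (deg (Q k) < deg (Q k.+1))%N & (deg c <= deg (Q k.+1))%N].
    elim: k => [|k [IH1 IH2 IH3]].
      by rewrite addn0 -dp1 -[Q 0%N]QE /=; split=> //; apply: leq_trans dp.
    have E := Qrec k; rewrite !QE in E.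
    have Qk0 : Q k.+1 != 0 by apply: deg_gt0; lia.
    have Qk2 : deg (Q k.+2) = (deg a + deg c + deg (Q k.+1))%N.
      by apply: (deg_up_down K0 _ _ _ _ _ _ E) => //; lia.
    by split; rewrite ?Qk2 ?IH1; lia.
  by rewrite dp1; case: (dQ m).
- have [q E] := orbit_mod Es m.+1 pst0; exists q.
  by rewrite dE E.
- have [q E] := orbit_root Es (Z, X, u) m.+1; exists q.
  by move: E; rewrite -stE /=; case: (odd m) => /= ->; ring.
- by apply: (Jrec (Z, X, u)); rewrite ?sqrrN ?expr1n.
- by move=> m0; rewrite -P1E' dE m0.
- by move=> m1; rewrite -P1E' dE m1;
    apply: (step_reg Es (expr1n _ 2) (orbit_on_pair Es 1 pst0)).
Qed.

(** The two regular completions satisfy [e e' = (c - a - b)^2 - 4 (ab + 1)], of degree at most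
    [2 deg b], while [deg e' = deg a + 2 deg b]. So [e = 0], or [a] and [e] are constant; then
    [e = a], [a^2 = -1], and [reg a a b c] collapses to [(2 a - b - c)^2 = 0]. *)
Lemma equal_degree_triple a b c r s t : r ^+ 2 = a * b + 1 -> s ^+ 2 = a * c + 1 ->
  t ^+ 2 = b * c + 1 -> a != 0 -> (0 < deg b)%N -> (deg a <= deg b)%N -> deg b = deg c -> J a ->
  (c - a - b) ^+ 2 = 4 * (a * b + 1) \/ [/\ deg a = 0%N, a ^+ 2 = -1 & c = 2 * a - b].
Proof.
move=> Er Es Et a0 db dab dbc Ja.
have b0 := deg_gt0 db; have c0 : c != 0 by apply: deg_gt0; lia.
have [|||r' r'E D] := up_exists K0 _ _ _ a0 b0 c0 Er Es Et; try lia.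
have {r'E} Er' : r' ^+ 2 = a * b + 1 by case: r'E => ->; rewrite ?sqrrN.
set e' := _ + _ in D; pose e := a + b + c + 2 * a * b * c - 2 * r' * s * t.
have P : e * e' = (c - a - b) ^+ 2 - 4 * (a * b + 1).
  by rewrite /e /e'; ring: Er' Es Et.
have [e0|e0] := eqVneq e 0.
  by left; apply/eqP; rewrite -subr_eq0 -P e0 mul0r.
have e'0 : e' != 0 by apply: deg_gt0; lia.
have : (deg ((c - a - b) ^+ 2 - 4 * (a * b + 1)) <= deg b + deg b)%N by degbound.
rewrite -P degM // D => dee; right.
have [da de] : deg a = 0%N /\ deg e = 0%N by lia.
have E1 : (b * s - r' * t) ^+ 2 = e * b + 1 by rewrite /e; ring: Er' Es Et.
have E2 : (a * t - r' * s) ^+ 2 = e * a + 1 by rewrite /e; ring: Er' Es Et.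
have ea : e = a := two_consts K0 E1 Er' e0 a0 de da db.
rewrite ea in E2; have [a2 _] := self_pair Ja a0 E2.
split=> //.
have R : reg a b c a.
  apply: (@regP _ _ _ _ (- (r' * s * t))); first by ring: Er' Es Et.
  by rewrite -{1}ea /e; ring.
have {}R := reg_swap23 (reg_swap34 R).
have /eqP : (a + a - b - c) ^+ 2 = 0 by rewrite R -expr2 a2; ring.
by rewrite sqrf_eq0 subr_eq0 => /eqP <-; ring.
Qed.

End Integral.
End Chain.

(** * The two largest degrees among [a], [b], [c] equal *)

Section ChainBottoms.
Variable K : fieldType.
Hypothesis K0 : [pchar K] =i pred0.
Variable J : {poly K} -> Prop.
Hypothesis J_unit : forall a w : K, J a%:P -> w ^+ 2 = 2 * a * w + 1 -> a != 0 -> a ^+ 2 = -1.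
Implicit Types a b c d e p q r s t u v x y z w X Z : {poly K}.

Lemma mul2_inj p q : 2 * p = 2 * q -> p = q.
Proof. by move/(mulfI (two_neq0 K0)). Qed.

Lemma reg0_root a b c r : reg a b c 0 -> r ^+ 2 = a * b + 1 ->
  exists2 r', r' ^+ 2 = a * b + 1 & c = a + b + 2 * r'.
Proof.
move=> R Er; have : (a + b - c) ^+ 2 = (2 * r) ^+ 2.
  by transitivity ((a + b - c - 0) ^+ 2); [ring | rewrite R; ring: Er].
move/eqP; rewrite eqf_sqr => /orP[] /eqP E; [exists (- r) | exists r]; rewrite ?sqrrN //.
  by transitivity (a + b - (a + b - c)); [ring | rewrite E; ring].
by transitivity (a + b - (a + b - c)); [ring | rewrite E; ring].
Qed.

Lemma zero_or_reflect a b c r s t : r ^+ 2 = a * b + 1 -> s ^+ 2 = a * c + 1 ->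
  t ^+ 2 = b * c + 1 -> a != 0 -> (0 < deg b)%N -> (deg a <= deg b)%N -> deg b = deg c -> J a ->
  reg a b c 0 \/ [/\ deg a = 0%N, a ^+ 2 = -1 & c = 2 * a - b].
Proof.
move=> Er Es Et a0 db dab dbc Ja.
have [E|] := equal_degree_triple K0 J_unit Er Es Et a0 db dab dbc Ja; [left|by right].
by rewrite /reg mulr0 add0r mulr1 -E; ring.
Qed.

Section ChainFacts.
Variables (a c s z d : {poly K}) (m : nat) (Z X u v : {poly K}).
Hypothesis Es : s ^+ 2 = a * c + 1.
Hypothesis C : chain J a c s z d m Z X u v.
Local Notation P1 := (2 * (a + c + u + 2 * a * c * u) - v).

Lemma chain_reg : reg a c u v.
Proof.
apply: (@regP _ _ _ _ (- (s * X * Z))); last by rewrite (chv C); ring.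
by have EZ := chZ C; have EX := chX C; ring: Es EZ EX.
Qed.

Lemma chain_reg1 : reg a c u P1.
Proof.
apply: (@regP _ _ _ _ (s * X * Z)); last by rewrite (chv C); ring.
by have EZ := chZ C; have EX := chX C; ring: Es EZ EX.
Qed.

Lemma chain_prod : P1 * v = (a + c - u) ^+ 2 - 4 * (a * c + 1).
Proof.
by rewrite (chv C); have EZ := chZ C; have EX := chX C; ring: Es EZ EX.
Qed.

Lemma chain_root_cv : (s * Z - c * X) ^+ 2 = c * v + 1.
Proof. by rewrite (chv C); have EZ := chZ C; have EX := chX C; ring: Es EZ EX. Qed.

Lemma chain_root_av : (s * X - a * Z) ^+ 2 = a * v + 1.
Proof. by rewrite (chv C); have EZ := chZ C; have EX := chX C; ring: Es EZ EX. Qed.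

Lemma chain_root_uv : (u * s - X * Z) ^+ 2 = u * v + 1.
Proof. by rewrite (chv C); have EZ := chZ C; have EX := chX C; ring: Es EZ EX. Qed.

(** The residue of [z] modulo [c] does not depend on the chain, so this makes the bottoms of two
    chains comparable through [z]. *)
Lemma chain_rep : exists rho q, z = rho + c * q /\ rho ^+ 2 = c * (if odd m then u else v) + 1.
Proof.
case: (chz C) => q E; exists (if odd m then Z else s * Z - c * X), q; split=> //.
by case: (odd m); rewrite ?(chZ C) ?chain_root_cv.
Qed.

Hypothesis a0 : a != 0.
Hypothesis dc : (0 < deg c)%N.

(** If [a] and [u] are constant, they coincide and [a a + 1] is a square. Otherwise [c^2] dominates
    [P1 v], and since [P1] has degree [deg a + deg u + deg c], that of [v] follows. *)
Lemma chain_cases_lt : (deg a < deg c)%N -> J a ->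
  [\/ u = 0, [/\ deg a = 0%N, a ^+ 2 = -1, u = a & v = 2 * a - c] |
     [/\ u != 0, v != 0, (0 < deg a + deg u)%N, (deg v + deg a + deg u = deg c)%N &
       deg P1 = (deg a + deg u + deg c)%N]].
Proof.
move=> dac Ja; have c0 := deg_gt0 dc.
have [->|u0] := eqVneq u 0; first by constructor 1.
have duc := chu C.
have [|du] := posnP (deg a + deg u).
  move/eqP; rewrite addn_eq0 => /andP[/eqP da /eqP du]; constructor 2.
  have EZ : Z ^+ 2 = u * c + 1 by rewrite (chZ C); ring.
  have ua : u = a := two_consts K0 EZ Es u0 a0 du da dc.
  have EX : X ^+ 2 = a * a + 1 by rewrite (chX C) ua.
  have [a2 X0] := self_pair K0 J_unit Ja a0 EX.
  split=> //; rewrite (chv C) X0 ua; ring: a2.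
constructor 3.
have D : deg (P1 * v) = (deg c + deg c)%N.
  have -> : P1 * v = (c - a - u) ^+ 2 - 4 * (a * u + 1) by rewrite chain_prod; ring.
  have D1 : deg (c - a - u) = deg c by rewrite !degD_eq ?degN //; rewrite degD_eq ?degN.
  have D2 : (deg (- (4 * (a * u + 1))) <= deg a + deg u)%N by degbound.
  have D3 : deg ((c - a - u) ^+ 2) = (2 * deg c)%N by rewrite degX2 D1.
  rewrite degD_eq D3; first by lia.
  by apply: leq_ltn_trans D2 _; lia.
have n0 : P1 * v != 0 by apply: deg_gt0; rewrite D; lia.
have v0 : v != 0 by move: n0; rewrite mulf_eq0 negb_or => /andP[].
have P0 : P1 != 0 by move: n0; rewrite mulf_eq0 negb_or => /andP[].
rewrite degM // in D; have dp := chp C.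
have PE : P1 + v = 2 * (a + u + c + 2 * a * u * c) by ring.
have DP : deg P1 = (deg a + deg u + deg c)%N.
  by apply: (deg_up_down K0 _ _ _ _ _ _ PE) => //; lia.
by split => //; lia.
Qed.

(** Now [P1 v] has degree at most [2 deg c] whereas [deg P1 = deg u + 2 deg c], so nonzero [u] and
    [v] are constant, hence equal, and [reg u u a c] collapses to [(2 u - a - c)^2 = 0]. *)
Lemma chain_cases_eq : deg a = deg c ->
  [\/ u = 0, u != 0 /\ v = 0 |
     [/\ u != 0, deg u = 0%N, u ^+ 2 = -1, c = 2 * u - a & v = u /\ deg P1 = (deg a + deg c)%N]].
Proof.
move=> dac; have c0 := deg_gt0 dc.
have [->|u0] := eqVneq u 0; first by constructor 1.
have [->|v0] := eqVneq v 0; first by constructor 2.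
constructor 3; have duc := chu C; have dp := chp C.
have n0 : P1 != 0 by apply: deg_gt0; lia.
have : (deg ((a + c - u) ^+ 2 - 4 * (a * c + 1)) <= deg c + deg c)%N by degbound.
rewrite -chain_prod degM // => D.
have PE : P1 + v = 2 * (u + a + c + 2 * u * a * c) by ring.
have DP : deg P1 = (deg u + deg a + deg c)%N.
  by apply: (deg_up_down K0 _ _ _ _ _ _ PE) => //; lia.
have [du dv] : deg u = 0%N /\ deg v = 0%N by lia.
have EZ : Z ^+ 2 = u * c + 1 by rewrite (chZ C); ring.
have EV : (s * Z - c * X) ^+ 2 = v * c + 1 by rewrite chain_root_cv; ring.
have vu : v = u by apply: (two_consts K0 EV EZ).
have [u2 _] : u ^+ 2 = -1 /\ u * s - X * Z = 0.
  by apply: (self_pair K0 J_unit (chJu C)); rewrite // chain_root_uv vu.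
split=> //; last by split=> //; rewrite DP du; lia.
have R : reg u u a c.
  have := chain_reg; rewrite vu => R.
  exact: (reg_swap23 (reg_swap34 (reg_swap12 (reg_swap23 R)))).
have /eqP : (u + u - a - c) ^+ 2 = 0 by rewrite R -expr2 u2; ring.
by rewrite sqrf_eq0 subr_eq0 => /eqP <-; ring.
Qed.
End ChainFacts.

End ChainBottoms.

(** * All three degrees equal *)

Section EqualDegrees.
Variable K : fieldType.
Hypothesis K0 : [pchar K] =i pred0.
Variable J : {poly K} -> Prop.
Hypothesis J_reg : forall a c p q, J a -> J c -> J p -> reg a c p q -> J q.
Hypothesis J_unit : forall a w : K, J a%:P -> w ^+ 2 = 2 * a * w + 1 -> a != 0 -> a ^+ 2 = -1.
Implicit Types a b c d e p q r s t u v x y z w X Z : {poly K}.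

Lemma lin2 (A B : int) a r : a != 0 -> (deg a < deg r)%N ->
  A%:~R * a + B%:~R * r = 0 -> A = 0 /\ B = 0.
Proof.
move=> a0 dar E; have r0 : r != 0 by apply: deg_gt0; lia.
have B0 : B = 0.
  apply/eqP; apply: contraT => B0.
  have dB : deg (B%:~R * r) = deg r by rewrite degM ?intP_neq0 // deg_int.
  have : (deg (- (A%:~R * a)) <= deg a)%N by degbound.
  have -> : - (A%:~R * a) = B%:~R * r.
    by apply/eqP; rewrite eq_sym -addr_eq0 addrC E.
  by rewrite dB; lia.
split=> //; move/eqP: E; rewrite B0 mul0r addr0 mulf_eq0 (negPf a0) orbF.
by apply: contraTeq => /(intP_neq0 K0).
Qed.

(** Modulo [c] the relation [reg a b c 0] reads [(a - b)^2 = 4], so [c] would divide the nonzero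
    constant [4 k^2]. *)
Lemma reg0_diff a b c (k : nat) q : reg a b c 0 -> (0 < deg c)%N -> (k != 0)%N ->
  k%:R * (a - b) = c * q -> False.
Proof.
move=> R dc k0 E.
have F : c * (c * q ^+ 2 - 2 * k%:R ^+ 2 * (a + b) + k%:R ^+ 2 * c) = 4 * k%:R ^+ 2.
  transitivity ((c * q) ^+ 2 - (k%:R * (a - b)) ^+ 2
    + k%:R ^+ 2 * ((a + b - c - 0) ^+ 2 - 4 * a * b)); first by ring.
  by rewrite R -E; ring.
have kk : 4 * k%:R ^+ 2 != 0 :> {poly K} by rewrite mulf_neq0 ?expf_neq0 ?natP_neq0.
have := kk; rewrite -F mulf_eq0 negb_or => /andP[c0 w0].
have : (deg (4 * k%:R ^+ 2 : {poly K}) <= 0)%N by degbound.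
by rewrite -F degM //; lia.
Qed.

(** The completions of [(a, c, 0)] are [b] and [2 (a + c) - b], both of degree [deg c]. They are the
    candidates for [v] when [u = 0], and they are too large for [u] when [v = 0]. *)
Lemma chain_cases_eq_reg0 a c b s z d m Z X u v : s ^+ 2 = a * c + 1 -> chain J a c s z d m Z X u v ->
  a != 0 -> (0 < deg c)%N -> deg a = deg c -> deg b = deg c -> reg a c b 0 ->
  deg (2 * (a + c) - b) = deg c ->
  (exists f, [/\ u = 0, f = b \/ f = 2 * (a + c) - b, v = f &
     deg (2 * (a + c + u + 2 * a * c * u) - v) = deg c]) \/
  [/\ u != 0, deg u = 0%N, c = 2 * u - a &
     deg (2 * (a + c + u + 2 * a * c * u) - v) = (deg a + deg c)%N].
Proof.
move=> Es C a0 dc dac dbc R D.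
have R0 := reg_swap34 R; have Ruv := chain_reg Es C.
case: (chain_cases_eq K0 J_unit Es C a0 dc dac) => [u0|[u0 v0]|[u0 du _ cE [_ dP]]]; last by right.
  left; exists v; rewrite u0 in Ruv *; rewrite !(mulr0, addr0).
  have [vb|vb] := reg_uniq Ruv R0.
    by split=> //; [left|rewrite vb].
  have vE : v = 2 * (a + c) - b by transitivity (v + b - b); [ring|rewrite vb; ring].
  split=> //; first by right.
  by rewrite vE -dbc; congr deg; ring.
rewrite v0 in Ruv; have := chu C.
have [->|E] := reg_uniq (reg_swap34 Ruv) R0; first by rewrite dbc ltnn.
have -> : u = 2 * (a + c) - b by transitivity (u + b - b); [ring|rewrite E; ring].
by rewrite D ltnn.
Qed.

Lemma reg_equal_degrees_pivot a b c d s t x y z : s ^+ 2 = a * c + 1 ->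
  t ^+ 2 = b * c + 1 -> x ^+ 2 = a * d + 1 -> y ^+ 2 = b * d + 1 -> z ^+ 2 = c * d + 1 ->
  a != 0 -> b != 0 -> a != b -> (0 < deg c)%N -> deg a = deg c -> deg b = deg c ->
  (deg c <= deg d)%N -> reg a b c 0 ->
  deg (2 * (a + c) - b) = deg c -> deg (2 * (b + c) - a) = deg c ->
  J a -> J b -> J c -> J d -> reg a b c d.
Proof.
move=> Es Et Ex Ey Ez a0 b0 ab dc dac dbc dcd R Dac Dbc Ja Jb Jc Jd.
have [|m [Z [X [u [v C]]]]] := chain_exists K0 J_reg Es Ez Ex a0 dc _ dcd Ja Jc Jd; try lia.
have [|m' [Z' [X' [u' [v' C']]]]] := chain_exists K0 J_reg Et Ez Ey b0 dc _ dcd Jb Jc Jd; try lia.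
have Hd := chd C; have Hd' := chd C'; rewrite Hd in Hd'.
have c0 := deg_gt0 dc.
case: (chain_cases_eq_reg0 Es C a0 dc dac dbc (reg_swap23 R) Dac) => [[f [u0 vf ve dP]]|[u0 du cE dP]];
case: (chain_cases_eq_reg0 Et C' b0 dc dbc dac (reg_swap23 (reg_swap12 R)) Dbc)
   => [[f' [u0' vf' ve' dP']]|[u0' du' cE' dP']]; rewrite dP dP' in Hd'.
- have mm : m' = m by nia.
  subst m' u u' f f'.
  have [q E] := chm C; have [q' E'] := chm C'.
  have D : m.+1%:R * (m.+2%:R * a - v) - m.+1%:R * (m.+2%:R * b - v') = c * (q' - q).
    transitivity ((d - c * q) - (d - c * q')); last by ring.
    by rewrite {1}E E'; ring.
  case: vf => vf; case: vf' => vf'; rewrite vf vf' in D.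
  + apply: False_ind; apply: (@reg0_diff a b c (m.+1 * m.+3)%N (q' - q)) => //.
    by rewrite -D; ring.
  + apply: False_ind; apply: (@reg0_diff a b c (m.+1 * m.+1)%N (q' - q - 2 * m.+1%:R)) => //.
    by rewrite [RHS]mulrBr -D; ring.
  + apply: False_ind; apply: (@reg0_diff a b c (m.+1 * m.+1)%N (q' - q + 2 * m.+1%:R)) => //.
    by rewrite [RHS]mulrDr -D; ring.
  (* With both reflected values the congruence is [(m + 1)(m - 1)(a - b) = 0] modulo [c]. Only
     [m = 1] survives, where [b] is the entry just below [d]. *)
  have [m1|m1] := eqVneq m 1%N.
    have := ch1 C m1; rewrite vf !(mulr0, addr0).
    have -> : 2 * (a + c) - (2 * (a + c) - b) = b by ring.
    by move/reg_swap23.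
  apply: False_ind; case: m m1 D {Hd Hd' dP dP' C C' E E'} => [|[|k]] // _ D.
    by apply: (@reg0_diff a b c 1 (q - q')) => //;
       transitivity (- (c * (q' - q))); [rewrite -D | ]; ring.
  apply: (@reg0_diff a b c (k.+3 * k.+1)%N (q' - q)) => //.
  by rewrite -D; ring.
(* One bottom is zero and the other a constant: [deg d] would be both an odd and an even multiple of
   [deg c]. *)
- have /eqP : (deg c * (1 + 2 * m) = deg c * (2 + 2 * m'))%N by rewrite dac dbc in Hd'; nia.
  by rewrite eqn_mul2l; lia.
- have /eqP : (deg c * (2 + 2 * m) = deg c * (1 + 2 * m'))%N by rewrite dac dbc in Hd'; nia.
  by rewrite eqn_mul2l; lia.
have uu : u = u'.
  have EZ : Z ^+ 2 = u * c + 1 by rewrite (chZ C); ring.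
  have EZ' : Z' ^+ 2 = u' * c + 1 by rewrite (chZ C'); ring.
  exact: (two_consts K0 EZ EZ').
case/eqP: ab; transitivity (2 * u - c); first by rewrite cE; ring.
by rewrite cE' uu; ring.
Qed.

(** In terms of [f] and [h] the relation becomes [(f - h)^2 - 18 c (f + h) + 81 c^2 = 36], where
    [81 c^2] would dominate. *)
Lemma not_both_short a b c : deg a = deg c -> deg b = deg c -> reg a b c 0 -> (0 < deg c)%N ->
  (deg (2 * (a + c) - b) < deg c)%N -> (deg (2 * (b + c) - a) < deg c)%N -> False.
Proof.
move=> da db R dc; have c0 := deg_gt0 dc.
have [f fE] : exists f : {poly K}, f = 2 * (a + c) - b by eexists.
have [h hE] : exists h : {poly K}, h = 2 * (b + c) - a by eexists.
rewrite -fE -hE => Df Dh.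
have E : 81 * c ^+ 2 = 36 - (f - h) ^+ 2 + 18 * c * (f + h).
  transitivity (36 - (f - h) ^+ 2 + 18 * c * (f + h)
    + 9 * ((a + b - c - 0) ^+ 2 - 4 * (a * b + 1) * (c * 0 + 1))).
    by rewrite fE hE; ring.
  by rewrite R subrr mulr0 addr0.
have : (deg (36 - (f - h) ^+ 2 + 18 * c * (f + h)) < 2 * deg c)%N.
  by degbound.
by rewrite -E degM ?natP_neq0 ?expf_neq0 // deg_nat degX2; lia.
Qed.

End EqualDegrees.

(** * Two equal top degrees, and the choice of the pivot *)

Section TopDegreesEqual.
Variable K : fieldType.
Hypothesis K0 : [pchar K] =i pred0.
Variable J : {poly K} -> Prop.
Hypothesis J_reg : forall a c p q, J a -> J c -> J p -> reg a c p q -> J q.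
Hypothesis J_unit : forall a w : K, J a%:P -> w ^+ 2 = 2 * a * w + 1 -> a != 0 -> a ^+ 2 = -1.
Implicit Types a b c d e f p q r s t u v x y z w X Z : {poly K}.

Lemma deg_root_lt c f p : p ^+ 2 = c * f + 1 -> (0 < deg c)%N -> (deg f < deg c)%N ->
  (deg p < deg c)%N.
Proof.
move=> E dc df; have c0 := deg_gt0 dc.
have [f0|f0] := eqVneq f 0; last by have := deg_sqrt E c0 f0; lia.
by have := degX2 p; rewrite E f0 mulr0 add0r deg1; lia.
Qed.

(** Both roots have degree below [deg c], so each is the remainder of [z] modulo [c]. *)
Lemma rep_match c f f' p p' q q' z : z = p + c * q -> z = p' + c * q' ->
  p ^+ 2 = c * f + 1 -> p' ^+ 2 = c * f' + 1 -> (0 < deg c)%N ->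
  (deg f < deg c)%N -> (deg f' < deg c)%N -> f = f'.
Proof.
move=> Ez Ez' Ep Ep' dc df df'.
have dp := deg_root_lt Ep dc df; have dp' := deg_root_lt Ep' dc df'.
have [||/eqP] := @small_mul K c (p - p') (q' - q).
- by degbound.
- by transitivity ((z - c * q) - (z - c * q')); [rewrite {1}Ez Ez'|]; ring.
rewrite subr_eq0 => /eqP pp _; apply: (mulfI (deg_gt0 dc)); apply: (addIr 1).
by rewrite -Ep -Ep' pp.
Qed.

(** The residue of [z] would make [u] or [v] equal to [a]; then [a a + 1] is a square, [a] is
    constant, and the degrees no longer add up. *)
Lemma chain_far_absurd a c s z d m Z X u v f' p' q' : s ^+ 2 = a * c + 1 -> chain J a c s z d m Z X u v ->
  a != 0 -> (0 < deg c)%N -> (deg a < deg c)%N ->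
  z = p' + c * q' -> p' ^+ 2 = c * f' + 1 -> f' = 0 \/ f' = a ->
  u != 0 -> v != 0 -> (0 < deg a + deg u)%N -> (deg v + deg a + deg u = deg c)%N -> False.
Proof.
move=> Es C a0 dc dac Ez Ep f'E u0 v0 dau dvau.
have [p [q [Ez' Ep']]] := chain_rep Es C.
have duc := chu C.
have E : (if odd m then u else v) = f'.
  apply: (rep_match Ez' Ez Ep' Ep dc); first by case: ifP; lia.
  by case: f'E => ->; rewrite ?deg0.
have uv : u = a \/ v = a.
  case: f'E E => ->; case: ifP => _ E; first 1 last; try by [left|right].
  - by rewrite E eqxx in v0.
  - by rewrite E eqxx in u0.
have da : deg a = 0%N.
  case: uv => E'.
    by have := chX C; rewrite E' => /(self_square K0).
  by have := chain_root_av Es C; rewrite E' => /(self_square K0).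
by case: uv => E'; subst; lia.
Qed.

(** Here [c = a + b + 2 r1], so [b] is [- a - 2 r1] modulo [c]. As [deg a < deg r1 < deg c], the
    coefficients of [a] and [r1] can be compared, and each pair of bottoms yields two integer
    equations in [M = m + 1] and [N = n + 1]. *)
Lemma reg_short_first a b c d r x y z : r ^+ 2 = a * b + 1 -> x ^+ 2 = a * d + 1 ->
  y ^+ 2 = b * d + 1 -> z ^+ 2 = c * d + 1 -> a != 0 -> (deg a < deg b)%N -> deg b = deg c ->
  (deg c <= deg d)%N -> reg a b c 0 -> J a -> J b -> J c -> J d -> reg a b c d.
Proof.
move=> Er Ex Ey Ez a0 dab dbc dcd R Ja Jb Jc Jd.
have [r1 Er1 cE] := reg0_root R Er.
have db : (0 < deg b)%N by lia.
have dc : (0 < deg c)%N by lia.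
have dac : (deg a < deg c)%N by lia.
have b0 := deg_gt0 db; have c0 := deg_gt0 dc.
have dr := deg_sqrt Er1 a0 b0.
have dar : (deg a < deg r1)%N by lia.
have drc : (deg r1 < deg c)%N by lia.
have Es : (a + r1) ^+ 2 = a * c + 1 by rewrite cE; ring: Er1.
have Et : (b + r1) ^+ 2 = b * c + 1 by rewrite cE; ring: Er1.
have [|m [Z [X [u [v C]]]]] := chain_exists K0 J_reg Es Ez Ex a0 dc _ dcd Ja Jc Jd; try lia.
have [|n [Z' [X' [u' [v' C']]]]] := chain_exists K0 J_reg Et Ez Ey b0 dc _ dcd Jb Jc Jd; try lia.
have Rb : reg b c 0 a by apply: reg_swap34; apply: reg_swap23; apply: reg_swap12.
have Ra : reg a c 0 b by apply: reg_swap34; apply: reg_swap23.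
(* The completions of [(b, c, 0)] are [a] and [4 b + a + 4 r1]. The second is too large for [u']; as
   [v'] over [u' = 0] it would make [a] the next entry, which must have degree at least [deg c]. *)
have H' : u' = 0 /\ v' = a \/ u' = a /\ v' = 0.
  have R' := chain_reg Et C'.
  case: (chain_cases_eq K0 J_unit Et C' b0 dc dbc) => [u0|[u0 v0]|[u0 du _ cE' _]].
  - left; split=> //; rewrite u0 in R'; have [//|E] := reg_uniq R' Rb.
    have := chp C'; rewrite u0; have -> : 2 * (b + c + 0 + 2 * b * c * 0) - v' = a; last by lia.
    transitivity (2 * (b + c + 0 + 2 * b * c * 0) - (v' + a) + a); first by ring.
    by rewrite E subrr add0r.
  - right; split=> //; rewrite v0 in R'; have [//|E] := reg_uniq (reg_swap34 R') Rb.
    have : (deg u' < deg c)%N := chu C'.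
    have -> : u' = 4 * b + (a + 4 * r1).
      transitivity (u' + a - a); first by ring.
      by rewrite E cE; ring.
    have D4 : deg (4 * b) = deg b by rewrite degM ?natP_neq0 // deg_nat.
    have D5 : (deg (a + 4 * r1) < deg (4 * b))%N by rewrite D4; degbound.
    by rewrite degD_eq // D4; lia.
  - have D : (deg (2 * u' - a - 2 * r1) < deg b)%N by have duc' := chu C'; rewrite dbc; degbound.
    have : 2 * u' - a - 2 * r1 = 2 * b.
      transitivity ((2 * u' - b) - (a + b + 2 * r1) + 2 * b); first by ring.
      by rewrite -cE' -cE; ring.
    by move=> E; rewrite E degM ?natP_neq0 // deg_nat ltnn in D.
have [p' [q' [Ez' Ep']]] := chain_rep Et C'.
have f'E : (if odd n then u' else v') = 0 \/ (if odd n then u' else v') = a.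
  by case: H' => -[-> ->]; case: odd; auto.
have fin (A B : int) w : A%:~R * a + B%:~R * r1 = c * w -> A = 0 /\ B = 0.
  move=> E; have [|E0 _] := small_mul _ E; last exact: (lin2 K0 a0 dar E0).
  by degbound.
have [q E] := chm C; have [q1 E1] := chm C'.
have bE : b = c - a - 2 * r1 by rewrite cE; ring.
have key (A B : int) w : m.+2%:R * u - m.+1%:R * v + a * (m.+1%:R * m.+2%:R) -
   (n.+2%:R * u' - n.+1%:R * v' + b * (n.+1%:R * n.+2%:R))
   = A%:~R * a + B%:~R * r1 + c * w -> A = 0 /\ B = 0.
  move=> F; apply: (fin A B (q1 - q - w)).
  transitivity (A%:~R * a + B%:~R * r1 + c * w - c * w); first by ring.
  rewrite -F; transitivity ((d - c * q) - (d - c * q1) - c * w); last by ring.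
  by rewrite {1}E E1; ring.
pose M : int := m.+1%:Z; pose N : int := n.+1%:Z.
case: (chain_cases_lt K0 J_unit Es C a0 dc dac Ja) => [u0|[da a2 ua va]|[u0 v0 h1 h2 _]]; last first.
- by case: (chain_far_absurd Es C a0 dc dac Ez' Ep' f'E u0 v0 h1 h2).
- case: H' => -[u'E v'E]; rewrite ua va u'E v'E bE in key.
    have [] := key (M * M + 1 + N * N + 2 * N) (2 * N * N + 2 * N)
      (m.+1%:R - n.+1%:R * n.+2%:R); first by rewrite /M /N; ring.
    by rewrite /M /N; nia.
  have [] := key (M * M + N * N) (2 * N * N + 2 * N)
      (m.+1%:R - n.+1%:R * n.+2%:R); first by rewrite /M /N; ring.
  by rewrite /M /N; nia.
have Rv := chain_reg Es C; rewrite u0 in Rv.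
have [vb|vb] := reg_uniq Rv Ra.
- case: H' => -[u'E v'E]; rewrite u0 vb u'E v'E bE in key.
    have [] := key (M * M + 2 * M + N * N + 2 * N) (2 * M + 2 * N * N + 2 * N)
      (- m.+1%:R - n.+1%:R * n.+2%:R); first by rewrite /M /N; ring.
    by rewrite /M /N; nia.
  have [] := key (M * M + 2 * M - 1 + N * N) (2 * M + 2 * N * N + 2 * N)
      (- m.+1%:R - n.+1%:R * n.+2%:R); first by rewrite /M /N; ring.
  by rewrite /M /N; nia.
have {}vb : v = 2 * (a + c) - b by transitivity (v + b - b); [ring|rewrite vb; ring].
case: H' => -[u'E v'E]; rewrite u0 vb u'E v'E bE in key.
  have [] := key (M * M - 2 * M + N * N + 2 * N) (- 2 * M + 2 * N * N + 2 * N)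
      (- m.+1%:R - n.+1%:R * n.+2%:R); first by rewrite /M /N; ring.
  rewrite /M /N => H1 H2.
  have MN : m.+1%:Z = n.+1%:Z * n.+1%:Z + n.+1%:Z by lia.
  by rewrite MN in H1; nia.
(* The one solvable system: [M = 2], [N = 1], so [d] is the entry following [u' = a] on [(b, c)]. *)
have [] := key (M * M - 2 * M - 1 + N * N) (- 2 * M + 2 * N * N + 2 * N)
      (- m.+1%:R - n.+1%:R * n.+2%:R); first by rewrite /M /N; ring.
rewrite /M /N => H1 H2.
have MN : m.+1%:Z = n.+1%:Z * n.+1%:Z + n.+1%:Z by lia.
have n0 : n = 0%N by rewrite MN in H1; nia.
have := chain_reg1 Et C'; rewrite -(ch0 C' n0) u'E => RR.
exact: (reg_swap12 (reg_swap23 RR)).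
Qed.


Lemma imaginary_unit_irrational (k : int) (N : nat) a e : a ^+ 2 = -1 -> e ^+ 2 = 1 -> (N != 0)%N ->
  k%:~R * a = N%:R * e -> False.
Proof.
move=> a2 e2 N0 E.
have F : (k * k + N%:Z * N%:Z)%:~R = 0 :> {poly K}.
  transitivity ((N%:R * e) ^+ 2 - (k%:~R * a) ^+ 2); first by ring: a2 e2.
  by rewrite E subrr.
have := @intP_neq0 K K0 (k * k + N%:Z * N%:Z); rewrite F eqxx => H.
suff /H : k * k + N%:Z * N%:Z != 0 by [].
by nia.
Qed.

(** Modulo [c], [b] is the constant [2 a] and the root [a (b - a)] of [b c + 1] is -1, so the chain
    of [(b, c)] is constant there. If [u = 0], the chain of [(a, c)] carries a nonzero multiple of
    [s], of degree [deg c / 2]. If [u = a], an integer relation remains; it is solvable only when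
    [M^2 = 2 N (N + 1)], with [M = m + 1] and [N = n + 1], and the degrees add [M = 2 N]. *)
Lemma reg_reflected a b c d s x y z : s ^+ 2 = a * c + 1 -> x ^+ 2 = a * d + 1 ->
  y ^+ 2 = b * d + 1 -> z ^+ 2 = c * d + 1 -> deg a = 0%N -> a ^+ 2 = -1 -> c = 2 * a - b ->
  (0 < deg b)%N -> deg b = deg c -> (deg c <= deg d)%N ->
  J a -> J b -> J c -> J d -> reg a b c d.
Proof.
move=> Es Ex Ey Ez da a2 cE db dbc dcd Ja Jb Jc Jd.
have dc : (0 < deg c)%N by lia.
have a0 : a != 0.
  by apply/eqP => a0; move/eqP: a2; rewrite a0 expr2 mul0r eq_sym oppr_eq0 oner_eq0.
have dac : (deg a < deg c)%N by lia.
have b0 := deg_gt0 db; have c0 := deg_gt0 dc.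
have Et : (a * (b - a)) ^+ 2 = b * c + 1 by rewrite cE; ring: a2.
have ds := deg_sqrt Es a0 c0.
have [|m [Z [X [u [v C]]]]] := chain_exists K0 J_reg Es Ez Ex a0 dc _ dcd Ja Jc Jd; try lia.
have [|n [Z' [X' [u' [v' C']]]]] := chain_exists K0 J_reg Et Ez Ey b0 dc _ dcd Jb Jc Jd; try lia.
have bE : b = 2 * a - c by rewrite cE; ring.
have H' : (exists2 e, e ^+ 2 = 1 /\ u' = 0 & v' = b + c - 2 * (a * (b - a)) * e) \/
          u' = a /\ v' = a /\ deg (2 * (b + c + u' + 2 * b * c * u') - v') = (deg b + deg c)%N.
  case: (chain_cases_eq K0 J_unit Et C' b0 dc dbc) => [u0|[u0 v0]|[u0 du _ cE' [vu dP]]].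
  - left; exists (X' * Z'); last by rewrite (chv C') u0; ring.
    split=> //; have EZ := chZ C'; have EX := chX C'; rewrite u0 mulr0 add0r in EZ; rewrite u0 mulr0 add0r in EX.
    by ring: EZ EX.
  (* [u'] would be [b + c] plus or minus [2 a (b - a)]; as [b + c] is constant, the term in [a b]
     keeps its degree at [deg c]. *)
  - have R' := chain_reg Et C'; rewrite v0 in R'.
    have [t1 Et1 uE] := reg0_root R' Et.
    have : (deg u' < deg c)%N := chu C'.
    have /eqP : t1 ^+ 2 = (a * (b - a)) ^+ 2 by rewrite Et1 Et.
    have dt (k : int) : k != 0 -> deg (k%:~R * a * b + (2 * a + k%:~R)) = deg b.
      move=> k0; have D : deg (k%:~R * a * b) = deg b.
        by rewrite !degM ?mulf_neq0 ?intP_neq0 // da deg_int.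
      have D2 : (deg (2 * a + k%:~R) < deg (k%:~R * a * b))%N by rewrite D; degbound.
      by rewrite degD_eq.
    rewrite eqf_sqr => /orP[] /eqP t1E; rewrite uE t1E.
      have -> : b + c + 2 * (a * (b - a)) = 2%:~R * a * b + (2 * a + 2%:~R).
        by rewrite cE; ring: a2.
      by rewrite dt // dbc ltnn.
    have -> : b + c + 2 * - (a * (b - a)) = (-2)%:~R * a * b + (2 * a + (-2)%:~R).
      by rewrite cE; ring: a2.
    by rewrite dt // dbc ltnn.
  right; have u'a : u' = a; last by do 2 split=> //; rewrite vu.
  apply: (mul2_inj K0); transitivity (c + b); first by rewrite {1}cE'; ring.
  by rewrite cE; ring.
have [p' [q' [f' [Ez' Ep' f'E]]]] : exists p' q' f',
    [/\ z = p' + c * q', p' ^+ 2 = c * f' + 1 & f' = 0 \/ f' = a].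
  case: H' => [[e [e2 u'E] v'E]|[u'E [v'E _]]].
    have [q Eq] := chz C'; case: (odd n) Eq => Eq.
      by exists Z', q, 0; split; [|rewrite (chZ C') u'E|left].
    (* From [b = 2 a - c] and [a^2 = -1], the root [a (b - a)] equals [-1 - a c], so the residue of
       [z] is [- Z']. *)
    exists (- Z'), (q - a * Z' - X'), 0; split; [|by rewrite sqrrN (chZ C') u'E|by left].
    by rewrite Eq bE; ring: a2.
  have [p' [q [Eq Ep]]] := chain_rep Et C'.
  exists p', q, (if odd n then u' else v'); split=> //.
  by right; case: ifP.
have [q E] := chm C; have [q1 E1] := chm C'.
have key p w : m.+2%:R * u - m.+1%:R * v + a * (m.+1%:R * m.+2%:R) -
   (n.+2%:R * u' - n.+1%:R * v' + b * (n.+1%:R * n.+2%:R))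
   = p + c * w -> (deg p < deg c)%N -> p = 0.
  move=> F dp; have [||] // := @small_mul K c p (q1 - q - w).
  transitivity (p + c * w - c * w); first by ring.
  rewrite -F; transitivity ((d - c * q) - (d - c * q1) - c * w); last by ring.
  by rewrite {1}E E1; ring.
case: (chain_cases_lt K0 J_unit Es C a0 dc dac Ja) => [u0|[_ _ ua va]|[u0 v0 h1 h2 _]]; last first.
- by case: (chain_far_absurd Es C a0 dc dac Ez' Ep' f'E u0 v0 h1 h2).
- case: H' => [[e [e2 u'E] v'E]|[u'E [v'E dP']]].
    pose k : int := m.+1%:Z * m.+1%:Z + 1 - 2 * n.+1%:Z * n.+1%:Z.
    have de : deg e = 0%N by have := degX2 e; rewrite e2 deg1; lia.
    have /eqP H : k%:~R * a + (2 * n.+1)%:R * e = 0.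
      apply: (key _ (m.+1%:R + 2 * n.+1%:R * a * e + n.+1%:R * n.+2%:R)); last by degbound.
      by rewrite ua va u'E v'E bE /k; ring: a2.
    case: (@imaginary_unit_irrational k (2 * n.+1) a (- e) a2) => //; first by rewrite sqrrN.
    by move: H; rewrite addr_eq0 => /eqP ->; ring.
  have /eqP : (m.+1%:Z * m.+1%:Z - 2 * n.+1%:Z * n.+2%:Z)%:~R * a = 0.
    apply: (key _ (m.+1%:R + n.+1%:R * n.+2%:R)); last by degbound.
    by rewrite ua va u'E v'E bE; ring.
  rewrite mulf_eq0 (negPf a0) orbF => H.
  have {}H : m.+1%:Z * m.+1%:Z - 2 * n.+1%:Z * n.+2%:Z = 0.
    by apply/eqP; apply: contraTT H => /(intP_neq0 K0).
  have PE : 2 * (a + c + u + 2 * a * c * u) - v = 2 * a - c.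
    by rewrite ua va; ring: a2.
  have dP : deg (2 * (a + c + u + 2 * a * c * u) - v) = deg c.
    by rewrite PE -bE.
  have Hd := chd C; rewrite (chd C') dP dP' da dbc add0n in Hd.
  have M2 : (m.+1 = 2 * n.+1)%N.
    have /eqP : (deg c * m.+1 = deg c * (2 * n.+1))%N by nia.
    by rewrite eqn_mul2l; lia.
  have n0 : n = 0%N by rewrite M2 in H; nia.
  have := chain_reg1 Et C'; rewrite -(ch0 C' n0) u'E => RR.
  exact: (reg_swap12 (reg_swap23 RR)).
have EZ := chZ C; have EX := chX C; rewrite u0 mulr0 add0r in EZ; rewrite u0 mulr0 add0r in EX.
have dZ : deg Z = 0%N by have := degX2 Z; rewrite EZ deg1; lia.
have dX : deg X = 0%N by have := degX2 X; rewrite EX deg1; lia.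
have vE := chv C; rewrite u0 in vE.
have dsc : (0 < deg s < deg c)%N by lia.
have XZ0 : 2 * m.+1%:R * X * Z != 0.
  have nz p : p ^+ 2 = 1 -> p != 0 by move=> h; rewrite -sqrf_eq0 h oner_eq0.
  by rewrite !mulf_neq0 ?natP_neq0 ?nz.
have s0 : s != 0 by apply: deg_gt0; lia.
have fin p w : m.+2%:R * u - m.+1%:R * v + a * (m.+1%:R * m.+2%:R) -
   (n.+2%:R * u' - n.+1%:R * v' + b * (n.+1%:R * n.+2%:R))
   = (2 * m.+1%:R * X * Z) * s + p + c * w -> deg p = 0%N -> False.
  move=> F dp; have := key _ _ F.
  have D : (deg (2 * m.+1%:R * X * Z * s + p) < deg c)%N by degbound.
  move=> /(_ D) /eqP; rewrite addr_eq0 => /eqP /(congr1 (@deg K)).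
  have -> : deg (2 * m.+1%:R * X * Z * s) = deg s.
    rewrite degM //; have : (deg (2 * m.+1%:R * X * Z) <= 0)%N by degbound.
    by lia.
  by rewrite degN; lia.
case: H' => [[e [e2 u'E] v'E]|[u'E [v'E dP']]].
  have de : deg e = 0%N by have := degX2 e; rewrite e2 deg1; lia.
  case: (fin (a * (m.+1%:R ^+ 2) - 2 * n.+1%:R ^+ 2 * a + 2 * n.+1%:R * e)
      (- m.+1%:R + 2 * n.+1%:R * a * e + n.+1%:R * n.+2%:R)).
    by rewrite u0 vE u'E v'E bE; ring: a2.
  by apply/eqP; rewrite -leqn0; degbound.
case: (fin (a * (m.+1%:R ^+ 2) - a - 2 * n.+1%:R * n.+2%:R * a)
      (- m.+1%:R + n.+1%:R * n.+2%:R)).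
  by rewrite u0 vE u'E v'E bE; ring: a2.
by apply/eqP; rewrite -leqn0; degbound.
Qed.

Record quad a b c d : Prop := Quad {
  q_neq0 : [/\ a != 0, b != 0, c != 0 & d != 0];
  q_uniq : uniq [:: a; b; c; d];
  q_root3 : [/\ exists r, r ^+ 2 = a * b + 1, exists s, s ^+ 2 = a * c + 1
              & exists t, t ^+ 2 = b * c + 1];
  q_rootd : [/\ exists x, x ^+ 2 = a * d + 1, exists y, y ^+ 2 = b * d + 1
              & exists z, z ^+ 2 = c * d + 1];
  q_J : [/\ J a, J b, J c & J d] }.

(** When all three degrees agree, at most one of the forms [2 (p + q) - w] is short, by
    [not_both_short]; the [w] of that form, if there is one, serves as the pivot. *)
Lemma reg_quad_equal_degrees a b c d : quad a b c d -> (deg a <= deg b)%N -> deg b = deg c ->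
  (deg c <= deg d)%N -> (0 < deg b)%N -> reg a b c d.
Proof.
case=> [[a0 b0 c0 d0] U [[r Er] [s Es] [t Et]] [[x Ex] [y Ey] [z Ez]] [Ja Jb Jc Jd]].
move=> dab dbc dcd db; have dc : (0 < deg c)%N by first [dlia | lia].
have [ab bc ca] : [/\ a <> b, c <> b & a <> c].
  move: U; rewrite /= !inE !negb_or => /and4P[/and3P[/eqP ab /eqP ac _] /andP[/eqP bc _] _ _].
  by split=> // h; apply: bc.
move/eqP: ab => ab; move/eqP: bc => bc; move/eqP: ca => ca.
clear U d0.
case: (zero_or_reflect K0 J_unit Er Es Et a0 db dab dbc Ja) => [R|[da a2 cE]]; last first.
  by apply: (reg_reflected Es Ex Ey Ez).
have [lt|ge] := ltnP (deg a) (deg b); first by apply: (reg_short_first Er Ex Ey Ez).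
have dba : deg a = deg b by first [dlia | lia].
have Er' : r ^+ 2 = b * a + 1 by rewrite Er; ring.
have Es' : s ^+ 2 = c * a + 1 by rewrite Es; ring.
have Et' : t ^+ 2 = c * b + 1 by rewrite Et; ring.
have le3 (p q w : {poly K}) : deg p = deg c -> deg q = deg c -> deg w = deg c -> (deg (2 * (p + q) - w) <= deg c)%N.
  by move=> dp dq dr; degbound.
have [h1|h1] := eqVneq (deg (2 * (a + c) - b)) (deg c).
  have [h2|h2] := eqVneq (deg (2 * (b + c) - a)) (deg c).
    by apply: (reg_equal_degrees_pivot K0 J_reg J_unit Es Et Ex Ey Ez) => //; first [dlia | lia].
  have l2 : (deg (2 * (b + c) - a) < deg c)%N by rewrite ltn_neqAle h2 le3 //; first [dlia | lia].
  have [h3|h3] := eqVneq (deg (2 * (a + b) - c)) (deg c).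
    have H : reg c b a d; last by exact: (reg_swap23 (reg_swap12 (reg_swap23 H))).
    apply: (reg_equal_degrees_pivot K0 J_reg J_unit Es' Er' Ez Ey Ex); try first [dlia | lia]; try done.
    - by apply: reg_swap23; apply: reg_swap12; apply: reg_swap23.
    - by transitivity (deg c); [rewrite -h1; congr deg; ring | first [dlia | lia]].
    - by rewrite [b + a]addrC h3; first [dlia | lia].
  have l3 : (deg (2 * (a + b) - c) < deg c)%N by rewrite ltn_neqAle h3 le3 //; first [dlia | lia].
  apply: False_ind; apply: (@not_both_short K K0 a c b); [first [dlia | lia] | first [dlia | lia] | exact: reg_swap23 | done | |].
    by apply: leq_trans l3 _; first [dlia | lia].
  by have -> : 2 * (c + b) - a = 2 * (b + c) - a; [ring | apply: leq_trans l2 _; first [dlia | lia]].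
have l1 : (deg (2 * (a + c) - b) < deg c)%N by rewrite ltn_neqAle h1 le3 //; first [dlia | lia].
have h2 : deg (2 * (b + c) - a) = deg c.
  apply/eqP; apply: contraT => h2.
  have l2 : (deg (2 * (b + c) - a) < deg c)%N by rewrite ltn_neqAle h2 le3 //; first [dlia | lia].
  by apply: False_ind; apply: (@not_both_short K K0 a b c) => //; first [dlia | lia].
have h3 : deg (2 * (a + b) - c) = deg c.
  apply/eqP; apply: contraT => h3.
  have l3 : (deg (2 * (a + b) - c) < deg c)%N by rewrite ltn_neqAle h3 le3 //; first [dlia | lia].
  apply: False_ind; apply: (@not_both_short K K0 b c a);
    [first [dlia | lia] | first [dlia | lia] | by apply: reg_swap23; apply: reg_swap12 | first [dlia | lia] | |].
    by have -> : 2 * (b + a) - c = 2 * (a + b) - c; [ring | apply: leq_trans l3 _; first [dlia | lia]].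
  by have -> : 2 * (c + a) - b = 2 * (a + c) - b; [ring | apply: leq_trans l1 _; first [dlia | lia]].
have H : reg a c b d; last by exact: reg_swap23.
apply: (reg_equal_degrees_pivot K0 J_reg J_unit Er Et' Ex Ez Ey); try first [dlia | lia]; try done.
- by apply: reg_swap23.
- by rewrite [c + b]addrC h2; first [dlia | lia].
Qed.

End TopDegreesEqual.

(** * Comparing the two chains *)

(** For positive [N] the right side lies strictly between [N^2] and [(N + 1)^2]; the symmetry
    exchanging [N] and [- N - 1] covers the negative values. *)
Lemma not_square_between (M : nat) (N : int) : (0 < M)%N -> N != 0 -> N != -1 ->
  M%:Z * M%:Z = N * N + N + 1 -> False.
Proof.
have nat_case (P : nat) : (0 < P)%N -> (M * M = P * P + P + 1)%N -> False.
  move=> P0 E; have [h|h] := leqP M P; last by nia.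
  by have := leq_mul h h; lia.
move=> M0; case: N => [n|[|n]] // n0 _ E.
  by apply: (nat_case n); [lia | lia].
by apply: (nat_case n.+1) => //; rewrite NegzE in E; lia.
Qed.

(** The equation left in [match_pair_pair] after eliminating [N = 1 + M - M^2]. The product
    [(M + 1)(2 - M)^2] exceeds 2 from [M = 3] on and is negative below -1. *)
Lemma cubic_integer_root (M : int) : M != 0 -> M != -1 ->
  (M + 1) * ((M + 1) * (2 - M) * (2 - M) - 2) = 0 -> M = 1.
Proof.
move=> M0 M1 /eqP; rewrite mulf_eq0 addr_eq0 (negPf M1) /= subr_eq0 => /eqP.
case: M M0 {M1} => [[|[|[|n]]]|n] // _.
  have -> : (n.+3%:Z + 1) * (2 - n.+3%:Z) * (2 - n.+3%:Z) = (n.+4 * (n.+1 * n.+1))%N%:Z by lia.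
  by case; nia.
rewrite NegzE.
have -> : (- n.+1%:Z + 1) * (2 - - n.+1%:Z) * (2 - - n.+1%:Z) = - (n * (n.+3 * n.+3))%N%:Z by lia.
by lia.
Qed.

Section Congruences.
Variable K : fieldType.
Hypothesis K0 : [pchar K] =i pred0.
Variable J : {poly K} -> Prop.
Hypothesis J_unit : forall a w : K, J a%:P -> w ^+ 2 = 2 * a * w + 1 -> a != 0 -> a ^+ 2 = -1.
Implicit Types a b c d e f p q r s t u v x y z w X Z : {poly K}.

(** [(w - h p^2)(w + h p^2) = C p^2]. The factors differ by [2 h p^2], so one has degree at least
    [2 deg p] and the other is a constant [g]; then [p^2] divides [g^2], so [g = 0]. *)
Lemma square_mul_shift (h C : K) w p : h != 0 -> (0 < deg p)%N ->
  w ^+ 2 = p ^+ 2 * ((h ^+ 2)%:P * p ^+ 2 + C%:P) -> C = 0.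
Proof.
move=> h0 dp E; have p0 := deg_gt0 dp.
apply/eqP; apply: contraT => C0.
have F : (w - h%:P * p ^+ 2) * (w + h%:P * p ^+ 2) = C%:P * p ^+ 2.
  transitivity (w ^+ 2 - (h ^+ 2)%:P * (p ^+ 2 * p ^+ 2)); first by rewrite polyC_exp; ring.
  by rewrite E; ring.
have dF : deg (C%:P * p ^+ 2) = (2 * deg p)%N.
  by rewrite degM ?polyC_eq0 ?expf_neq0 // degC degX2.
have nF : C%:P * p ^+ 2 != 0 by rewrite mulf_neq0 ?polyC_eq0 ?expf_neq0.
have main (k : K) (g : {poly K}) : k != 0 -> g * (g + (2 * k)%:P * p ^+ 2) = C%:P * p ^+ 2 ->
    (2 * deg p <= deg (g + (2 * k)%:P * p ^+ 2))%N -> False.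
  move=> k0 G D; have g0 : g != 0 by apply: contraNneq nF => g0; rewrite -G g0 mul0r.
  have h1 : g + (2 * k)%:P * p ^+ 2 != 0 by apply: deg_gt0; lia.
  have := congr1 (@deg K) G; rewrite degM // dF => Dg.
  have /deg_eq0[G0 GE] : deg g = 0%N by lia.
  have [||g2 _] // := @small_mul K (p ^+ 2) ((G0 ^+ 2)%:P) ((C - 2 * k * G0)%:P).
  - by rewrite degC degX2; lia.
  - transitivity (g * (g + (2 * k)%:P * p ^+ 2) - g * ((2 * k)%:P * p ^+ 2)).
      by rewrite GE polyC_exp; ring.
    by rewrite G GE polyCB polyCM; ring.
  by case/eqP: g0; move/eqP: g2; rewrite GE polyC_eq0 sqrf_eq0 => /eqP->.
have dw : (2 * deg p <= maxn (deg (w + h%:P * p ^+ 2)) (deg (w - h%:P * p ^+ 2)))%N.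
  have <- : deg ((w + h%:P * p ^+ 2) - (w - h%:P * p ^+ 2)) = (2 * deg p)%N.
    have -> : (w + h%:P * p ^+ 2) - (w - h%:P * p ^+ 2) = (2 * h)%:P * p ^+ 2.
      by rewrite polyCM polyC_natr; ring.
    have k0 : 2 * h != 0 by rewrite mulf_neq0 ?natr_neq0.
    by rewrite degM ?polyC_eq0 ?expf_neq0 // degC degX2.
  by apply: degD_le; rewrite ?degN.
have [h1|h1] := leqP (2 * deg p) (deg (w + h%:P * p ^+ 2)).
  exfalso; apply: (main h (w - h%:P * p ^+ 2) h0).
    by rewrite -F polyCM polyC_natr; ring.
  by rewrite (_ : _ + _ = w + h%:P * p ^+ 2) // polyCM polyC_natr; ring.
have h2 : (2 * deg p <= deg (w - h%:P * p ^+ 2))%N by lia.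
exfalso; apply: (main (- h) (w + h%:P * p ^+ 2)); first by rewrite oppr_eq0.
  by rewrite -F !(polyCM, polyCN) polyC_natr; ring.
by rewrite (_ : _ + _ = w - h%:P * p ^+ 2) // !(polyCM, polyCN) polyC_natr; ring.
Qed.

(* Writing [eta = h p + th] with [h] rational, the hypotheses force [th^2 = 1] and
   [h^2 = 2 k h th + 1], so that [J_unit] makes [h^2 = -1]. *)
Lemma rational_slope (A N : int) (p k rho w eta l : {poly K}) : (0 < deg p)%N -> deg k = 0%N -> k != 0 -> J k ->
  rho ^+ 2 = p * k + 1 -> p * (w + k * eta) ^+ 2 = rho ^+ 2 * (k * eta ^+ 2 + p - k) ->
  N != 0 -> A != 0 -> deg l = 0%N -> N%:~R * eta = A%:~R * p + l -> False.
Proof.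
move=> dp dk k0 Jk Erho E N0 A0 /deg_eq0[L lE] Eeta; have p0 := deg_gt0 dp.
have /deg_eq0[kk kE] := dk; subst k l.
have n0 : N%:~R != 0 :> K by apply: intr_neq0.
have [h [th [h0 etaE hN]]] : exists h th : K,
    [/\ h != 0, eta = h%:P * p + th%:P & A%:~R = h * N%:~R :> K].
  exists (A%:~R / N%:~R), (L / N%:~R); split.
  - by rewrite mulf_neq0 ?invr_neq0 ?intr_neq0.
  - apply: (mulfI (intP_neq0 K0 N0)); rewrite Eeta mulrDr mulrA.
    rewrite -[N%:~R](rmorph_int polyC) -!polyCM.
    by rewrite ![N%:~R * (_ / _)]mulrC !divfK // [A%:~R%:P](rmorph_int polyC).
  - by rewrite divfK.
have [||e1 _] // := @small_mul K p (kk * (th ^+ 2 - 1))%:P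
    ((w + kk%:P * eta) ^+ 2 - kk%:P * (kk%:P * eta ^+ 2 + p - kk%:P) - 1
      - kk%:P * h%:P * (h%:P * p + 2 * th%:P)).
- by rewrite degC.
- transitivity (p * (w + kk%:P * eta) ^+ 2 - p * kk%:P * (kk%:P * eta ^+ 2 + p - kk%:P) - p
    - p * kk%:P * h%:P * (h%:P * p + 2 * th%:P)); last by ring.
  rewrite E Erho etaE polyCM polyCB polyC1 polyC_exp; ring.
have th2 : th ^+ 2 = 1.
  move/eqP: e1; rewrite polyC_eq0 mulf_eq0; rewrite polyC_eq0 in k0.
  by rewrite (negPf k0) subr_eq0 => /eqP.
have drho : (0 < deg rho)%N by have := deg_sqrt Erho p0 k0; rewrite degC; lia.
have F : (w + kk%:P * eta) ^+ 2
    = rho ^+ 2 * ((h ^+ 2)%:P * rho ^+ 2 + (1 + 2 * kk * h * th - h ^+ 2)%:P).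
  apply: (mulfI p0); rewrite E.
  have -> : kk%:P * eta ^+ 2 + p - kk%:P
     = p * ((h ^+ 2)%:P * (p * kk%:P + 1) + (1 + 2 * kk * h * th - h ^+ 2)%:P).
    have th2P : th%:P ^+ 2 = 1 by rewrite -polyC_exp th2.
    by rewrite etaE polyCB polyCD !polyCM polyC1 polyC_natr ?polyC_exp; ring: th2P.
  by rewrite -Erho; ring.
have C0 := square_mul_shift h0 drho F.
rewrite polyC_eq0 in k0.
have Ew : (h * th) ^+ 2 = 2 * kk * (h * th) + 1.
  rewrite exprMn th2 mulr1; apply/eqP; rewrite -subr_eq0 -oppr_eq0; apply/eqP.
  by rewrite -C0; ring.
have kk2 := J_unit Jk Ew k0.
have /eqP : (h * th - kk) ^+ 2 = 0.
  by transitivity ((h * th) ^+ 2 - 2 * kk * (h * th) + kk ^+ 2); [ring | rewrite Ew kk2; ring].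
rewrite sqrf_eq0 subr_eq0 => /eqP hE.
have h2 : h ^+ 2 = -1 by rewrite -kk2 -hE exprMn th2 mulr1.
have : (A ^+ 2 + N ^+ 2)%:~R = 0 :> K.
  rewrite rmorphD !rmorphXn /=.
  by rewrite hN exprMn h2; ring.
by move/(intr_inj0 K0); nia.
Qed.


(* [e] is the polynomial of smaller degree completing [a], [b], [c] regularly.  In the lemma names
   the first (second) word is the bottom [(u, v)] of the chain of [(a, c)] (of [(b, c)]): [zero] for
   [u = 0], [self] for [u = a] constant with [a^2 = -1], [pair] for [{u, v} = {b, e}] (resp.
   [{a, e}]).  For pairs, [M < -1] encodes [u = e] with [d] at index [-M - 1]. *)
Section Combos.
Variables a b c e r x y : {poly K}.
Hypotheses (Er : r ^+ 2 = a * b + 1) (Ex : x ^+ 2 = a * e + 1) (Ey : y ^+ 2 = b * e + 1).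
Hypothesis cE : c = a + b + e + 2 * a * b * e + 2 * r * x * y.
Hypotheses (a0 : a != 0) (e0 : e != 0).
Hypotheses (db : (0 < deg b)%N) (dab : (deg a <= deg b)%N) (dbc : (deg b < deg c)%N).
Hypothesis dabe : (deg e + deg a + deg b = deg c)%N.
Hypotheses (Ja : J a) (Je : J e).

Let b0 : b != 0. Proof. exact: deg_gt0. Qed.
Let c0 : c != 0. Proof. by apply: deg_gt0; lia. Qed.

(** [cE] makes [c] a regular completion of [(a, b, e)], so [a y + r x] is a root of [a c + 1]; the
    sign is absorbed into [x1] and [y1]. *)
Lemma root_ac_split s : s ^+ 2 = a * c + 1 -> exists x1 y1,
  [/\ x1 ^+ 2 = a * e + 1, y1 ^+ 2 = b * e + 1 & s = a * y1 + r * x1].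
Proof.
move=> Es; have /eqP : s ^+ 2 = (a * y + r * x) ^+ 2 by rewrite Es cE; ring: Er Ex Ey.
rewrite eqf_sqr => /orP[] /eqP ->; [exists x, y | exists (- x), (- y)]; split; rewrite ?sqrrN //.
by ring.
Qed.

Lemma root_bc_split t : t ^+ 2 = b * c + 1 -> exists x1 y1,
  [/\ x1 ^+ 2 = a * e + 1, y1 ^+ 2 = b * e + 1 & t = b * x1 + r * y1].
Proof.
move=> Et; have /eqP : t ^+ 2 = (b * x + r * y) ^+ 2 by rewrite Et cE; ring: Er Ex Ey.
rewrite eqf_sqr => /orP[] /eqP ->; [exists x, y | exists (- x), (- y)]; split; rewrite ?sqrrN //.
by ring.
Qed.

Lemma deg_intM (N : int) p : N != 0 -> deg (N%:~R * p) = deg p.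
Proof.
move=> N0; have [->|p0] := eqVneq p 0; first by rewrite mulr0.
by rewrite degM ?intP_neq0 // deg_int.
Qed.

Lemma const_eq_mul p (N : int) q : (0 < deg p)%N -> N%:~R = p * q -> N = 0.
Proof.
move=> dp E; have [|E0 _] := small_mul _ E; first by rewrite deg_int.
by apply/eqP; move/eqP: E0; apply: contraTT => /(intP_neq0 K0).
Qed.

(** If [deg a < deg b], the term in [t] dominates. Otherwise degrees force [M = N], and
    [t^2 - s^2 = (b - a) c] turns the relation into [M (t + s) = - 2 c], too small on the left. *)
Lemma no_match_zero_zero (M N : nat) s t : (0 < M)%N -> (0 < N)%N -> a != b ->
  s ^+ 2 = a * c + 1 -> t ^+ 2 = b * c + 1 ->
  (deg c + M.-1 * (deg a + deg c) = deg c + N.-1 * (deg b + deg c))%N ->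
  a * M%:R ^+ 2 + 2 * M%:R * s = b * N%:R ^+ 2 + 2 * N%:R * t -> False.
Proof.
move=> M0 N0 /eqP ab Es Et D E.
have ds := deg_sqrt Es a0 c0; have dt := deg_sqrt Et b0 c0.
have [lt|ge] := ltnP (deg a) (deg b).
  have F : (2 * N%:Z)%:~R * t = a * M%:R ^+ 2 + 2 * M%:R * s - b * N%:R ^+ 2.
    by rewrite E; ring.
  have : (deg (a * M%:R ^+ 2 + 2 * M%:R * s - b * N%:R ^+ 2) < deg t)%N by degbound.
  by rewrite -F deg_intM ?ltnn //; lia.
have dba : deg a = deg b by lia.
have NM : N = M.
  have /eqP : ((deg b + deg c) * M.-1 = (deg b + deg c) * N.-1)%N by rewrite dba in D; nia.
  by rewrite eqn_mul2l; lia.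
subst N; have M1 : M%:R != 0 :> {poly K} by rewrite natP_neq0 //; lia.
have F : M%:R * (a - b) = 2 * (t - s).
  apply: (mulfI M1); transitivity (a * M%:R ^+ 2 + 2 * M%:R * s - b * M%:R ^+ 2 - 2 * M%:R * s).
    by ring.
  by rewrite E; ring.
have G : M%:R * (t + s) = - (2 * c).
  have ab1 : a - b != 0 by rewrite subr_eq0; apply/eqP.
  apply: (mulfI ab1); transitivity (M%:R * (a - b) * (t + s)); first by ring.
  by rewrite F; ring: Es Et.
have : (deg (M%:R * (t + s)) < deg c)%N by degbound.
by rewrite G degN degM ?two_neq0 // deg_nat; lia.
Qed.

Lemma no_match_self_zero (M N : nat) t : (0 < N)%N -> t ^+ 2 = b * c + 1 ->
  a * (M%:R ^+ 2 + 1) = b * N%:R ^+ 2 + 2 * N%:R * t -> False.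
Proof.
move=> N0 Et E; have dt := deg_sqrt Et b0 c0.
have F : (2 * N%:Z)%:~R * t = a * (M%:R ^+ 2 + 1) - b * N%:R ^+ 2 by rewrite E; ring.
have : (deg (a * (M%:R ^+ 2 + 1) - b * N%:R ^+ 2) < deg t)%N by degbound.
by rewrite -F deg_intM ?ltnn //; lia.
Qed.

(** The relation is multiplied by the conjugate [eta = b x1 - r y1] of [t], which gives [e l] with
    [l = 2 N b - M eta] and degree at most [2 deg b]. Since [deg e = deg t = deg a + 2 deg b], a
    nonzero [l] forces [l] and [a] to be constant, which [rational_slope] excludes; if [l = 0], then
    [b] divides a nonzero integer. *)
Lemma no_match_pair_zero (M : int) (N : nat) t : (0 < N)%N -> t ^+ 2 = b * c + 1 ->
  (M + 1)%:~R * b - M%:~R * e + a * (M * (M + 1))%:~R = b * N%:R ^+ 2 + 2 * N%:R * t -> False.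
Proof.
move=> N0 Et E; have dt := deg_sqrt Et b0 c0.
have [x1 [y1 [Ex1 Ey1 tE]]] := root_bc_split Et.
pose q : {poly K} := (M + 1 - N%:Z * N%:Z)%:~R * b + (M * (M + 1))%:~R * a.
have qE : (2 * N%:Z)%:~R * t = q - M%:~R * e.
  transitivity (b * N%:R ^+ 2 + 2 * N%:R * t - b * N%:R ^+ 2); first by ring.
  by rewrite -E /q; ring.
have dq : (deg q <= deg b)%N by rewrite /q; degbound.
have N2 : 2 * N%:Z != 0 by lia.
have dNt := deg_intM t N2; rewrite qE in dNt.
have M0 : M != 0.
  by apply: contraTneq db => M0; move: dq; rewrite M0 mul0r subr0 in dNt; rewrite dNt; lia.
have dMe := deg_intM e M0.
have det : deg e = deg t.
  have : (deg (q - M%:~R * e) <= maxn (deg b) (deg e))%N by degbound.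
  have : (deg (q - (q - M%:~R * e)) <= maxn (deg b) (deg t))%N.
    by rewrite -dNt; apply: degD_le; rewrite ?degN.
  have -> : q - (q - M%:~R * e) = M%:~R * e by ring.
  by rewrite dMe dNt; lia.
pose eta : {poly K} := b * x1 - r * y1.
have teta : t * eta = b ^+ 2 - a * b - 1 - b * e by rewrite tE /eta; ring: Er Ex1 Ey1.
have deta : (deg eta <= deg b)%N.
  have [->|n0] := eqVneq eta 0; first by rewrite deg0.
  have : (deg (b ^+ 2 - a * b - 1 - b * e) <= deg b + deg e)%N by degbound.
  have t0 : t != 0 by apply: deg_gt0; lia.
  by rewrite -teta degM //; lia.
pose l : {poly K} := (2 * N%:Z)%:~R * b - M%:~R * eta.
have lE : e * l = (2 * N%:Z)%:~R * (b ^+ 2 - a * b - 1) - eta * q.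
  transitivity ((2 * N%:Z)%:~R * (t * eta + b * e) - eta * ((2 * N%:Z)%:~R * t + M%:~R * e)).
    by rewrite /l; ring.
  by rewrite teta qE; ring.
have Meta : M%:~R * eta = (2 * N%:Z)%:~R * b - l by rewrite /l; ring.
have [l0|l0] := eqVneq l 0.
  rewrite l0 mulr0 in lE; rewrite l0 subr0 in Meta.
  suff : 2 * N%:Z * M = 0 by nia.
  apply: (@const_eq_mul b _ ((2 * N%:Z)%:~R * (M%:~R * b - M%:~R * a - q))) => //.
  transitivity (M%:~R * ((2 * N%:Z)%:~R * (b ^+ 2 - a * b - 1) - eta * q)
    + (2 * N%:Z * M)%:~R); first by rewrite -lE; ring.
  transitivity ((2 * N%:Z)%:~R * M%:~R * (b ^+ 2 - a * b - 1) - (M%:~R * eta) * q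
    + (2 * N%:Z * M)%:~R); first by ring.
  by rewrite Meta; ring.
have dl : (deg ((2 * N%:Z)%:~R * (b ^+ 2 - a * b - 1) - eta * q) <= deg b + deg b)%N by degbound.
rewrite -lE degM // in dl.
apply: (@rational_slope (2 * N%:Z) M b a r x1 eta (- l)) => //.
- by lia.
- by rewrite Er; ring.
(* As [x1 + a eta = r (r x1 - a y1)], this is [r^2] times the Pell equation
   [b (r x1 - a y1)^2 - a eta^2 = b - a]. *)
- by rewrite /eta; ring: Er Ex1 Ey1.
- by rewrite degN; lia.
Qed.


Lemma quadratic_coefs A B C p : deg A = 0%N -> deg B = 0%N -> deg C = 0%N -> (0 < deg p)%N ->
  A * p ^+ 2 + B * p + C = 0 -> [/\ A = 0, B = 0 & C = 0].
Proof.
move=> dA dB dC dp E; have p0 := deg_gt0 dp.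
have A0 : A = 0.
  apply/eqP; apply: contraT => A0.
  have : (deg (- (B * p + C)) <= deg p)%N by degbound.
  have -> : - (B * p + C) = A * p ^+ 2.
    by transitivity (A * p ^+ 2 - (A * p ^+ 2 + B * p + C)); [ring | rewrite E subr0].
  by rewrite degM ?expf_neq0 // degX2; lia.
have B0 : B = 0.
  rewrite A0 mul0r add0r in E; apply/eqP; apply: contraT => B0.
  have : (deg (- C) <= 0)%N by degbound.
  have -> : - C = B * p by transitivity (B * p - (B * p + C)); [ring | rewrite E subr0].
  by rewrite degM //; lia.
by move: E; rewrite A0 B0 !mul0r !add0r.
Qed.

Lemma int_mul_eq0 (N : int) p : p != 0 -> N%:~R * p = 0 -> N = 0.
Proof.
move=> p0 /eqP; rewrite mulf_eq0 (negPf p0) orbF => H.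
by apply/eqP; apply: contraTT H => /(intP_neq0 K0).
Qed.

(** The conjugate is now [eta = a y1 - r x1]. In [main] the coefficient of [b] must be constant if
    [deg e < deg b], and that of [e] must vanish if [deg e > deg b]. If the degrees agree, [a] is
    constant and [zero_or_reflect] gives [e] explicitly. *)
Lemma no_match_zero_pair (M : nat) (N : int) s : (0 < M)%N -> N != 0 -> N != -1 ->
  s ^+ 2 = a * c + 1 ->
  a * M%:R ^+ 2 + 2 * M%:R * s = (N + 1)%:~R * a - N%:~R * e + b * (N * (N + 1))%:~R -> False.
Proof.
move=> M0 N0 N1 Es E; have ds := deg_sqrt Es a0 c0.
have [x1 [y1 [Ex1 Ey1 sE]]] := root_ac_split Es.
have NN0 : N * (N + 1) != 0 by nia.
have M2 : 2 * M%:Z != 0 by lia.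
pose q : {poly K} := (N + 1 - M%:Z * M%:Z)%:~R * a.
have qE : (2 * M%:Z)%:~R * s = q - N%:~R * e + (N * (N + 1))%:~R * b.
  transitivity (a * M%:R ^+ 2 + 2 * M%:R * s - a * M%:R ^+ 2); first by ring.
  by rewrite E /q; ring.
have dq : (deg q <= deg a)%N by rewrite /q; degbound.
have dMs := deg_intM s M2.
have dNe := deg_intM e N0; have dNb := deg_intM b NN0.
pose eta : {poly K} := a * y1 - r * x1.
have seta : s * eta = a ^+ 2 - a * b - 1 - a * e by rewrite sE /eta; ring: Er Ex1 Ey1.
have s0 : s != 0 by apply: deg_gt0; lia.
have deta : (deg s + deg eta <= deg a + maxn (deg b) (deg e))%N \/ eta = 0.
  have [->|n0] := eqVneq eta 0; [by right | left].
  have : (deg (a ^+ 2 - a * b - 1 - a * e) <= deg a + maxn (deg b) (deg e))%N by degbound.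
  by rewrite -seta degM.
have main : e * ((2 * M%:Z)%:~R * a - N%:~R * eta) + b * ((2 * M%:Z)%:~R * a + (N * (N + 1))%:~R * eta)
   = (2 * M%:Z)%:~R * (a ^+ 2 - 1) - eta * q.
  transitivity ((2 * M%:Z)%:~R * (s * eta + a * b + a * e) - eta * ((2 * M%:Z)%:~R * s
     + N%:~R * e - (N * (N + 1))%:~R * b)).
    by ring.
  by rewrite seta qE; ring.
case: (ltngtP (deg e) (deg b)) => deb.
- have lab : (deg a < deg b)%N.
    have : (deg (q - N%:~R * e + (N * (N + 1))%:~R * b) <= deg b)%N by degbound.
    by rewrite -qE dMs; lia.
  have dsb : deg s = deg b.
    have D : (deg (q - N%:~R * e) < deg ((N * (N + 1))%:~R * b))%N by rewrite dNb; degbound.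
    by rewrite -dMs qE addrC degD_eq.
  have da : (0 < deg a)%N by lia.
  have de : (deg eta <= deg a)%N by case: deta => [|->]; rewrite ?deg0; lia.
  pose l : {poly K} := (2 * M%:Z)%:~R * a + (N * (N + 1))%:~R * eta.
  have lE : b * l = (2 * M%:Z)%:~R * (a ^+ 2 - 1) - eta * q - e * ((2 * M%:Z)%:~R * a - N%:~R * eta).
    by rewrite -main /l; ring.
  have Neta : (N * (N + 1))%:~R * eta = (- (2 * M%:Z))%:~R * a + l by rewrite /l; ring.
  have [l0|l0] := eqVneq l 0.
    rewrite l0 mulr0 in lE; rewrite l0 addr0 in Neta.
    suff : 2 * M%:Z * (N * (N + 1)) = 0 by move/eqP; rewrite mulf_eq0 (negPf NN0) (negPf M2).
    apply: (@const_eq_mul a _ ((2 * M%:Z)%:~R * ((N * (N + 1))%:~R * (a - e) + q - N%:~R * e))) => //.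
    transitivity ((2 * M%:Z * (N * (N + 1)))%:~R + (N * (N + 1))%:~R * ((2 * M%:Z)%:~R * (a ^+ 2 - 1)
      - eta * q - e * ((2 * M%:Z)%:~R * a - N%:~R * eta))); first by rewrite -lE; ring.
    transitivity ((2 * M%:Z * (N * (N + 1)))%:~R + (N * (N + 1))%:~R * (2 * M%:Z)%:~R * (a ^+ 2 - 1)
      - ((N * (N + 1))%:~R * eta) * q - e * ((N * (N + 1))%:~R * (2 * M%:Z)%:~R * a
         - N%:~R * ((N * (N + 1))%:~R * eta))); first by ring.
    by rewrite Neta; ring.
  have dl : (deg ((2 * M%:Z)%:~R * (a ^+ 2 - 1) - eta * q - e * ((2 * M%:Z)%:~R * a - N%:~R * eta))
     <= deg a + maxn (deg a) (deg e))%N by degbound.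
  rewrite -lE degM // in dl.
  apply: (@rational_slope (- (2 * M%:Z)) (N * (N + 1)) a e x1 y1 eta l) => //; try lia.
  by rewrite /eta; ring: Er Ex1 Ey1.
- have dse : deg s = deg e.
    have D : (deg (q + (N * (N + 1))%:~R * b) < deg (- (N%:~R * e)))%N by rewrite degN dNe; degbound.
    have -> : deg e = deg (- (N%:~R * e) + (q + (N * (N + 1))%:~R * b)).
      by rewrite degD_eq // degN dNe.
    by rewrite -dMs qE; congr deg; ring.
  have da : (0 < deg a)%N by lia.
  have de : (deg eta <= deg a)%N by case: deta => [|->]; rewrite ?deg0; lia.
  have lE : (2 * M%:Z)%:~R * (a ^+ 2 - 1) - eta * q
       - b * ((2 * M%:Z)%:~R * a + (N * (N + 1))%:~R * eta)
     = e * ((2 * M%:Z)%:~R * a - N%:~R * eta) by rewrite -main; ring.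
  have [|E0 /eqP] := small_mul _ lE; first by degbound.
  rewrite subr_eq0 eq_sym => /eqP Neta.
  suff : 2 * M%:Z * N = 0 by move/eqP; rewrite mulf_eq0 (negPf N0) (negPf M2).
  apply: (@const_eq_mul a _ ((2 * M%:Z)%:~R * (N%:~R * a - q - b * (N%:~R + (N * (N + 1))%:~R)))) => //.
  transitivity ((2 * M%:Z * N)%:~R + N%:~R * ((2 * M%:Z)%:~R * (a ^+ 2 - 1) - eta * q
       - b * ((2 * M%:Z)%:~R * a + (N * (N + 1))%:~R * eta))); first by rewrite E0; ring.
  transitivity ((2 * M%:Z * N)%:~R + N%:~R * (2 * M%:Z)%:~R * (a ^+ 2 - 1) - (N%:~R * eta) * q
       - b * (N%:~R * (2 * M%:Z)%:~R * a + (N * (N + 1))%:~R * (N%:~R * eta))); first by ring.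
  by rewrite Neta; ring.
have da : deg a = 0%N.
  have : (deg (q - N%:~R * e + (N * (N + 1))%:~R * b) <= deg b)%N by degbound.
  by rewrite -qE dMs; lia.
have lab : (deg a < deg b)%N by lia.
have [R|[_ a2 eE]] := zero_or_reflect K0 J_unit Er Ex1 Ey1 a0 db dab (esym deb) Ja.
  have [r1 Er1 eE] := reg0_root R Er.
  have dr1 := deg_sqrt Er1 a0 b0.
  have dp : (0 < deg r1)%N by lia.
  (* Multiplied by [a], where [a b = r1^2 - 1], the relation is quadratic in [r1] with constant
     coefficients. Their vanishing gives [N = -2], [M sg a = 1] and [a^2 = 3], hence [3 M^2 = 1]. *)
  have fin (sg : int) : sg * sg = 1 -> s = sg%:~R * (2 * r1 ^+ 2 + 2 * a * r1 - 1) -> False.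
    move=> sg2 sE'.
    pose A : {poly K} := (4 * M%:Z * sg)%:~R * a - (N * N)%:~R.
    pose B : {poly K} := (4 * M%:Z * sg)%:~R * (a * a) + (2 * N)%:~R * a.
    pose C : {poly K} := (M%:Z * M%:Z - 1)%:~R * (a * a) - (2 * M%:Z * sg)%:~R * a + (N * N)%:~R.
    have d0 p : (deg p <= 0)%N -> deg p = 0%N by lia.
    have dA : deg A = 0%N by apply: d0; rewrite /A; degbound.
    have dB : deg B = 0%N by apply: d0; rewrite /B; degbound.
    have dC : deg C = 0%N by apply: d0; rewrite /C; degbound.
    have [|A0 B0 C0] := quadratic_coefs dA dB dC dp.
      transitivity (a * (a * M%:R ^+ 2 + 2 * M%:R * s)
        - a * ((N + 1)%:~R * a - N%:~R * e + b * (N * (N + 1))%:~R)).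
        by rewrite sE' eE /A /B /C; ring: Er1.
      by rewrite E subrr.
    have N2 : N = -2.
      have H : N * (N + 2) = 0.
        apply: (int_mul_eq0 a0); transitivity (B - a * A); first by rewrite /A /B; ring.
        by rewrite A0 B0; ring.
      by nia.
    have aE : (M%:Z * sg)%:~R * a = 1.
      apply: (mulfI (natP_neq0 K0 (n := 4) isT)).
      by transitivity (A + 4); [rewrite /A N2 | rewrite A0]; ring.
    have ae2 : a * a = 3.
      transitivity (3 + (M%:Z * M%:Z * (1 - sg * sg))%:~R * (a * a) + ((M%:Z * sg)%:~R * a - 1) ^+ 2 - C).
        by rewrite /C N2; ring.
      by rewrite C0 aE sg2; ring.
    suff : 3 * M%:Z * M%:Z * (sg * sg) - 1 = 0 by rewrite sg2; nia.
    apply: (@int_mul_eq0 _ 1); first exact: oner_neq0.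
    transitivity ((M%:Z * M%:Z * (sg * sg))%:~R * (3 - a * a) + ((M%:Z * sg)%:~R * a) ^+ 2 - 1); first by ring.
    by rewrite ae2 aE; ring.
  have yE : y1 = b + r1 \/ y1 = - (b + r1).
    have /eqP : y1 ^+ 2 = (b + r1) ^+ 2 by rewrite Ey1 eE; ring: Er1.
    by rewrite eqf_sqr => /orP[] /eqP ->; auto.
  have xE : r * x1 = r1 * (a + r1) \/ r * x1 = - (r1 * (a + r1)).
    have /eqP : (r * x1) ^+ 2 = (r1 * (a + r1)) ^+ 2.
      by rewrite !exprMn Ex1 Er Er1 eE; ring: Er1.
    by rewrite eqf_sqr => /orP[] /eqP ->; auto.
  have ds0 : (deg s <= 0)%N -> False by lia.
  case: yE => yE; case: xE => xE; rewrite yE xE in sE.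
  - by apply: (fin 1) => //; rewrite sE; ring: Er1.
  - by apply: ds0; rewrite (_ : s = -1); [degbound | rewrite sE; ring: Er1].
  - by apply: ds0; rewrite (_ : s = 1); [degbound | rewrite sE; ring: Er1].
  - by apply: (fin (-1)) => //; rewrite sE; ring: Er1.
have eta0 : eta = 0.
  apply: (mulfI s0); rewrite seta eE mulr0; ring: a2.
have sE' : s = 2 * a * y1.
  by transitivity (2 * a * y1 - eta); [rewrite sE /eta; ring | rewrite eta0 subr0].
have /eqP : s ^+ 2 = (2 * (b - a)) ^+ 2.
  by rewrite sE'; rewrite eE in Ey1; ring: a2 Ey1.
have fin (sg : int) : s = sg%:~R * 2 * (b - a) -> sg * sg = 1 -> False.
  move=> sE2 sg2.
  have [|H1 H2] := @lin2 K K0 (M%:Z * M%:Z - 4 * M%:Z * sg - (N + 1) + 2 * N)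
     (4 * M%:Z * sg - N - N * (N + 1)) a b a0 lab.
    transitivity ((a * M%:R ^+ 2 + 2 * M%:R * s)
        - ((N + 1)%:~R * a - N%:~R * e + b * (N * (N + 1))%:~R)).
      by rewrite sE2 eE; ring.
    by rewrite E subrr.
  have H3 : M%:Z * M%:Z = N * N + N + 1 by lia.
  exact: (not_square_between M0 N0 N1 H3).
rewrite eqf_sqr => /orP[] /eqP sE2; [apply: (fin 1) | apply: (fin (-1))] => //; rewrite sE2; ring.
Qed.

Lemma no_match_self_pair (M : nat) (N : int) : (0 < M)%N -> N != 0 -> N != -1 -> deg a = 0%N ->
  a * (M%:R ^+ 2 + 1) = (N + 1)%:~R * a - N%:~R * e + b * (N * (N + 1))%:~R -> False.
Proof.
move=> M0 N0 N1 da E; have NN0 : N * (N + 1) != 0 by nia.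
have lab : (deg a < deg b)%N by lia.
have eN : N%:~R * e = (N * (N + 1))%:~R * b + (N - M%:Z * M%:Z)%:~R * a.
  transitivity ((N + 1)%:~R * a + b * (N * (N + 1))%:~R
    - ((N + 1)%:~R * a - N%:~R * e + b * (N * (N + 1))%:~R)); first by ring.
  by rewrite -E; ring.
have deb : deg b = deg e.
  have D : (deg ((N - M%:Z * M%:Z)%:~R * a) < deg ((N * (N + 1))%:~R * b))%N.
    by rewrite (deg_intM b NN0); degbound.
  by rewrite -(deg_intM e N0) eN degD_eq // deg_intM.
have [R|[_ a2 eE]] := zero_or_reflect K0 J_unit Er Ex Ey a0 db dab deb Ja.
  have [r1 Er1 eE] := reg0_root R Er; have dr1 := deg_sqrt Er1 a0 b0.
  have F : (N * N)%:~R * b = (2 * N)%:~R * r1 + (M%:Z * M%:Z)%:~R * a.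
    transitivity ((N * (N + 1))%:~R * b + (N - M%:Z * M%:Z)%:~R * a
       - N%:~R * b - N%:~R * a + (M%:Z * M%:Z)%:~R * a); first by ring.
    by rewrite -eN eE; ring.
  have : (deg ((2 * N)%:~R * r1 + (M%:Z * M%:Z)%:~R * a) < deg b)%N by degbound.
  by rewrite -F deg_intM ?ltnn //; nia.
have [|H1 H2] := @lin2 K K0 (2 * N - (N - M%:Z * M%:Z)) (- N - N * (N + 1)) a b a0 lab.
  transitivity (N%:~R * e - ((N * (N + 1))%:~R * b + (N - M%:Z * M%:Z)%:~R * a)).
    by rewrite eE; ring.
  by rewrite eN subrr.
have /eqP : N * (N + 2) = 0 by lia.
rewrite mulf_eq0 (negPf N0) addr_eq0 => /eqP N2.
by case: (M) M0 H1 => [|[|k]] //; rewrite N2; lia.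
Qed.

(** The congruence is a linear relation [(N - M) e = nu a + mu b]. For [M = N] it leaves [M^2 = 1];
    otherwise [deg e <= deg b], and explicit forms of [e], the degrees of [d], or the square
    [a e + 1] give a contradiction. *)
Lemma match_pair_pair (M N : int) : M != 0 -> M != -1 -> N != 0 -> N != -1 -> a != b ->
  (exists k, M = 2 * k + 1) -> (exists k, N = 2 * k + 1) ->
  ((if (0 < M)%R then deg b + absz M * (deg a + deg c) else deg e + absz (M + 1)%R * (deg a + deg c)) =
   (if (0 < N)%R then deg a + absz N * (deg b + deg c) else deg e + absz (N + 1)%R * (deg b + deg c)))%N ->
  (M + 1)%:~R * b - M%:~R * e + a * (M * (M + 1))%:~R
   = (N + 1)%:~R * a - N%:~R * e + b * (N * (N + 1))%:~R -> M = 1 /\ N = 1.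
Proof.
move=> M0 M1 N0 N1 ab [kM oM] [kN oN] D E.
pose mu : int := N * N + N - M - 1; pose nu : int := N + 1 - M * M - M.
have F : (N - M)%:~R * e = nu%:~R * a + mu%:~R * b.
  transitivity ((M + 1)%:~R * b - M%:~R * e + a * (M * (M + 1))%:~R + N%:~R * e
    - (M + 1)%:~R * b - a * (M * (M + 1))%:~R); first by ring.
  by rewrite E /mu /nu; ring.
have [NM|NM] := eqVneq N M.
  have : (1 - M * M) = 0.
    have ab0 : a - b != 0 by rewrite subr_eq0.
    apply: (int_mul_eq0 ab0); transitivity (nu%:~R * a + mu%:~R * b).
      by rewrite /nu /mu NM; ring.
    by rewrite -F NM subrr mul0r.
  by split; nia.
have NM0 : N - M != 0 by lia.
have dF := deg_intM e NM0.
have : (deg (nu%:~R * a + mu%:~R * b) <= deg b)%N by degbound.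
rewrite -F dF leq_eqVlt => /orP[/eqP deb|deb].
  have [lab|gab] := ltnP (deg a) (deg b).
    have [R|[da a2 eE]] := zero_or_reflect K0 J_unit Er Ex Ey a0 db dab (esym deb) Ja.
      have [r1 Er1 eE] := reg0_root R Er; have dr1 := deg_sqrt Er1 a0 b0.
      have G : (2 * (N - M))%:~R * r1 = (nu - (N - M))%:~R * a + (mu - (N - M))%:~R * b.
        transitivity (nu%:~R * a + mu%:~R * b - (N - M)%:~R * (a + b)); last by ring.
        by rewrite -F eE; ring.
      have NM2 : 2 * (N - M) != 0 by lia.
      have dG := deg_intM r1 NM2; rewrite G in dG.
      exfalso; have [m0|m0] := eqVneq (mu - (N - M)) 0.
        have : (deg ((nu - (N - M))%:~R * a + (mu - (N - M))%:~R * b) <= deg a)%N.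
          by rewrite m0 mul0r addr0; degbound.
        by rewrite dG; lia.
      have D1 : (deg ((nu - (N - M))%:~R * a) < deg ((mu - (N - M))%:~R * b))%N.
        by rewrite (deg_intM b m0); degbound.
      by move: dG; rewrite addrC degD_eq // (deg_intM b m0); lia.
    exfalso; have [|H1 H2] := @lin2 K K0 (nu - 2 * (N - M)) (mu + (N - M)) a b a0 lab.
      transitivity (nu%:~R * a + mu%:~R * b - (N - M)%:~R * (2 * a - b)); first by ring.
      by rewrite -F eE; ring.
    rewrite /mu /nu in H1 H2.
    have NE : N = 1 + M - M * M by lia.
    have H : (M + 1) * ((M + 1) * (2 - M) * (2 - M) - 2) = 0 by rewrite NE in H2; lia.
    by have m1 := cubic_integer_root M0 M1 H; rewrite m1 in NE; lia.
  have dba : deg a = deg b by lia.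
  (* With three equal degrees [D] equates the two indices; as [M] and [N] are odd, their signs
     agree, so [M = N]. *)
  exfalso; move: D; rewrite dba deb -!(fun_if (fun k => (deg b + k * (deg b + deg c))%N)).
  move/addnI/eqP; rewrite eqn_mul2r => H.
  by move: H; case: ifP; case: ifP; lia.
exfalso; have [lab|gab] := ltnP (deg a) (deg b).
  have m0 : mu = 0.
    apply/eqP; apply: contraT => m0.
    have D1 : (deg (nu%:~R * a) < deg (mu%:~R * b))%N by rewrite (deg_intM b m0); degbound.
    by move: dF; rewrite F addrC degD_eq // (deg_intM b m0); lia.
  rewrite m0 mul0r addr0 in F.
  have nu0 : nu != 0.
    by apply: contraNneq NM0 => nu0; rewrite nu0 mul0r in F; rewrite (int_mul_eq0 e0 F).
  have n0 : (N - M)%:~R != 0 :> K by apply: intr_neq0.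
  have da : deg a = 0%N.
    apply: (@const_mul_square K K0 a (nu%:~R / (N - M)%:~R) x); last first.
      by rewrite mulf_neq0 ?invr_neq0 ?intr_neq0.
    rewrite Ex; congr (_ + 1); apply: (mulfI (intP_neq0 K0 NM0)).
    have kE : (N - M)%:~R * (nu%:~R / (N - M)%:~R)%:P = nu%:~R :> {poly K}.
      by rewrite -[(N - M)%:~R in LHS](rmorph_int polyC) -polyCM mulrC divfK // [_%:P](rmorph_int polyC).
    transitivity (a * ((N - M)%:~R * e)); first by ring.
    by rewrite F -kE; ring.
  have : (deg (nu%:~R * a) <= deg a)%N by degbound.
  by rewrite -F dF; lia.
have dba : deg a = deg b by lia.
rewrite dba in D; move: D.
set W := (deg b + deg c)%N; have WW : (deg b < W)%N by rewrite /W; lia.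
have sep k k' : (deg b + k * W = deg e + k' * W)%N -> False.
  move=> Q; have [h|h] := leqP k' k; first by have := leq_mul h (leqnn W); lia.
  by have := leq_mul h (leqnn W); rewrite mulSn; lia.
case: ifP => hM; case: ifP => hN.
- by move/addnI/eqP; rewrite eqn_mul2r; lia.
- by move/sep.
- by move/esym/sep.
- by move/addnI/eqP; rewrite eqn_mul2r; lia.
Qed.

End Combos.
End Congruences.

(** * [c] of larger degree than [a] and [b] *)

Section DominantThird.
Variable K : fieldType.
Hypothesis K0 : [pchar K] =i pred0.
Variable J : {poly K} -> Prop.
Hypothesis J_reg : forall a c p q, J a -> J c -> J p -> reg a c p q -> J q.
Hypothesis J_unit : forall a w : K, J a%:P -> w ^+ 2 = 2 * a * w + 1 -> a != 0 -> a ^+ 2 = -1.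
Implicit Types a b c d e f p q r s t u v x y z w X Z : {poly K}.

(** Two distinct completions have a sum of degree [deg a + deg p + deg c], so at most one lies below
    [deg c]. *)
Lemma reg_partner a c p q q' : reg a c p q -> reg a c p q' -> a != 0 -> p != 0 ->
  (0 < deg a + deg p)%N -> (deg a < deg c)%N -> (deg p < deg c)%N ->
  (deg q < deg c)%N -> (deg q' < deg c)%N -> q = q'.
Proof.
move=> R R' a0 p0 dap dac dpc dq dq'; have c0 : c != 0 by apply: deg_gt0; lia.
have [//|E] := reg_uniq R R'.
have : (deg (q + q') < deg c)%N by degbound.
have -> : q + q' = 2 * (a + p + c + 2 * a * p * c) by rewrite E; ring.
rewrite degM ?(two_neq0 K0) ?deg_nat ?(deg_triple_sum K0 dap) //; try lia.
by apply: deg_gt0; rewrite (deg_triple_sum K0 dap) //; lia.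
Qed.

Lemma eq_mod_small c d F F' q q' : d = F + c * q -> d = F' + c * q' ->
  (deg F < deg c)%N -> (deg F' < deg c)%N -> F = F'.
Proof.
move=> E E' dF dF'; have [||/eqP] := @small_mul K c (F - F') (q' - q).
- by degbound.
- by transitivity ((d - c * q) - (d - c * q')); [rewrite {1}E E'|]; ring.
by rewrite subr_eq0 => /eqP.
Qed.

Section Forms.
Variables (a c s z d : {poly K}) (m : nat) (Z X u v : {poly K}).
Hypothesis Es : s ^+ 2 = a * c + 1.
Hypothesis C : chain J a c s z d m Z X u v.
Hypothesis a0 : a != 0.
Hypothesis dac : (deg a < deg c)%N.

Lemma form_zero : u = 0 -> exists s1 q, [/\ s1 ^+ 2 = a * c + 1,
  d = a * m.+1%:R ^+ 2 + 2 * m.+1%:R * s1 + c * q &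
  deg d = (deg c + m.+1.-1 * (deg a + deg c))%N].
Proof.
move=> u0; have EZ := chZ C; have EX := chX C.
rewrite u0 mulr0 add0r in EZ; rewrite u0 mulr0 add0r in EX.
have [s1 s1E Es1] : exists2 s1, s1 = s * X * Z & s1 ^+ 2 = a * c + 1.
  by exists (s * X * Z) => //; ring: Es EZ EX.
have vE : v = a + c - 2 * s1 by rewrite (chv C) u0 s1E; ring.
have [q E] := chm C; exists s1, (q - m.+1%:R).
have c0 : c != 0 by apply: deg_gt0; lia.
have ds1 := deg_sqrt Es1 a0 c0; split=> //.
  by rewrite {1}E vE u0; ring.
have -> : deg d = (deg (c + (a + 2 * s1)) + m * (deg a + deg c))%N.
  by rewrite (chd C) vE u0; congr (deg _ + _)%N; ring.
have D : (deg (a + 2 * s1) < deg c)%N by degbound.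
by rewrite degD_eq.
Qed.

Lemma rep_zero : u = 0 -> exists p q f, [/\ z = p + c * q, p ^+ 2 = c * f + 1 & f = 0 \/ f = a].
Proof.
move=> u0; have EZ := chZ C; rewrite u0 mulr0 add0r in EZ.
have [q E] := chz C; case: ifP E => _ E.
  by exists Z, q, 0; split; rewrite ?EZ; [|ring|left].
exists (s * Z), (q - X), a; split; [by rewrite E; ring| |by right].
by rewrite exprMn EZ Es; ring.
Qed.

Lemma form_self : a ^+ 2 = -1 -> u = a -> v = 2 * a - c ->
  exists q, d = a * (m.+1%:R ^+ 2 + 1) + c * q.
Proof.
move=> a2 uE vE; have [q E] := chm C; exists (q + m.+1%:R).
by rewrite {1}E uE vE; ring.
Qed.

Lemma rep_self : a ^+ 2 = -1 -> u = a ->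
  exists p q f, [/\ z = p + c * q, p ^+ 2 = c * f + 1 & f = 0 \/ f = a].
Proof.
move=> a2 ua; have EZ := chZ C; have EX := chX C.
have [q E] := chz C; case: ifP E => _ E.
  by exists Z, q, a; split=> //; [rewrite EZ ua|right].
have X0 : X = 0.
  by apply/eqP; rewrite -sqrf_eq0 EX ua -expr2 a2 addNr.
have /eqP : Z ^+ 2 = s ^+ 2 by rewrite EZ Es ua; ring.
rewrite eqf_sqr => /orP[] /eqP ZE.
  exists 1, (q + a), 0; split; [|by ring|by left].
  by rewrite E X0 ZE; ring: Es.
exists (-1), (q - a), 0; split; [|by ring|by left].
by rewrite E X0 ZE; ring: Es.
Qed.

Variables b e : {poly K}.
Hypotheses (b0 : b != 0) (e0 : e != 0).
Hypotheses (dbc : (deg b < deg c)%N) (dec : (deg e < deg c)%N) (dab : (0 < deg a + deg b)%N).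
Hypothesis R : reg a b c e.

Lemma far_pair : (0 < deg a + deg u)%N -> (deg v + deg a + deg u = deg c)%N ->
  [\/ u = b, v = b, u = e | v = e] -> (u = b /\ v = e) \/ (u = e /\ v = b).
Proof.
move=> dau dvau H; have Ruv := chain_reg Es C; have duc := chu C.
have Rbe : reg a c b e by apply: reg_swap23.
have dvc : (deg v < deg c)%N by lia.
case: H => H; rewrite H in Ruv dau dvau.
- left; split=> //; exact: (reg_partner Ruv Rbe).
- by right; split=> //; apply: (reg_partner (reg_swap34 Ruv) Rbe).
- by right; split=> //; apply: (reg_partner Ruv (reg_swap34 Rbe)).
- by left; split=> //; apply: (reg_partner (reg_swap34 Ruv) (reg_swap34 Rbe)) => //; lia.
Qed.

(** The integer [M] is [m + 1] or [- (m + 2)]: replacing [M] by [- M - 1] exchanges [b] and [e], so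
    one formula serves both orders. If the entry selected by parity is [e], then [M] is odd. *)
Lemma form_far : (0 < deg a + deg e)%N -> b != e ->
  (deg (2 * (a + c + u + 2 * a * c * u) - v) = deg a + deg u + deg c)%N ->
  (u = b /\ v = e) \/ (u = e /\ v = b) ->
  exists (M : int) q, [/\ M != 0, M != -1,
    d = (M + 1)%:~R * b - M%:~R * e + a * (M * (M + 1))%:~R + c * q,
    deg d = (if (0 < M)%R then deg b + absz M * (deg a + deg c)
             else deg e + absz (M + 1)%R * (deg a + deg c))%N &
    ((if odd m then u else v) = e -> exists k, M = 2 * k + 1) /\
    (M = 1 -> m = 0%N /\ u = b)].
Proof.
move=> dae be dP H; have [q E] := chm C; have Hd := chd C; rewrite dP in Hd.
case: H => -[ub ve]; rewrite ub ve in E Hd.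
  exists m.+1%:Z, q; split => //; [by rewrite {1}E; ring | by rewrite Hd /=; lia |].
  split; last by case=> ->.
  rewrite ub ve; case: ifP => om; first by move=> h; rewrite h eqxx in be.
  by move=> _; exists m./2%:Z; have := odd_double_half m; rewrite om; lia.
exists (- m.+2%:Z), q; split => //; [by rewrite {1}E; ring | |].
  have -> : (0 < - m.+2%:Z) = false by lia.
  have -> : absz (- m.+2%:Z + 1) = m.+1 by lia.
  by rewrite Hd; lia.
split; last by lia.
rewrite ub ve; case: ifP => om; last by move=> h; rewrite h eqxx in be.
by move=> _; exists (- (m./2%:Z + 2)); have := odd_double_half m; rewrite om; lia.
Qed.

End Forms.


(** [e] is the smaller regular completion of [(a, b, c)], of degree [deg c - deg a - deg b]. A
    bottom that is not far gives [z] a residue that forces the far one opposite to be a pair; two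
    far bottoms share [fa = fb]. *)
Lemma reg_quad_dominant_third a b c d : quad J a b c d -> (deg a <= deg b)%N -> (deg b < deg c)%N ->
  (deg c <= deg d)%N -> (0 < deg b)%N ->
  (forall f, quad J a b c f -> (deg f < deg c)%N -> reg a b c f) -> reg a b c d.
Proof.
case=> [[a0 b0 c0 d0] U [[r Er] [s Es] [t Et]] [[x Ex] [y Ey] [z Ez]] [Ja Jb Jc Jd]].
move=> dab dbc dcd db IH; have dc : (0 < deg c)%N by dlia.
have ab : a != b by move: U; rewrite /= !inE !negb_or; case: (a =P b).
have dac : (deg a < deg c)%N by dlia.
have [|||r1 r1E D] := up_exists K0 _ _ _ a0 b0 c0 Er Es Et; try dlia.
have Er1 : r1 ^+ 2 = a * b + 1 by case: r1E => ->; rewrite ?sqrrN.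
have [e eE] : exists e, e = a + b + c + 2 * a * b * c - 2 * r1 * s * t by eexists.
have Rabce : reg a b c e.
  by apply: (@regP _ _ _ _ (- (r1 * s * t))); [ring: Er1 Es Et | rewrite eE; ring].
have Je : J e by apply: J_reg Rabce.
have [x1 x1E] : exists x1, x1 = r1 * s - a * t by eexists.
have [y1 y1E] : exists y1, y1 = r1 * t - b * s by eexists.
have Ex1 : x1 ^+ 2 = a * e + 1 by rewrite x1E eE; ring: Er1 Es Et.
have Ey1 : y1 ^+ 2 = b * e + 1 by rewrite y1E eE; ring: Er1 Es Et.
have cE : c = a + b + e + 2 * a * b * e + 2 * r1 * x1 * y1.
  by rewrite x1E y1E eE; ring: Er1 Es Et.
have [e0 dabe] : e != 0 /\ (deg e + deg a + deg b = deg c)%N.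
  have P : e * (a + b + c + 2 * a * b * c + 2 * r1 * s * t)
     = (c - a - b) ^+ 2 - 4 * (a * b + 1) by rewrite eE; ring: Er1 Es Et.
  have D1 : deg (c - a - b) = deg c by rewrite !degD_eq ?degN //; rewrite degD_eq ?degN.
  have D2 : (deg (- (4 * (a * b + 1))) <= deg a + deg b)%N by degbound.
  have D3 : deg ((c - a - b) ^+ 2) = (2 * deg c)%N by rewrite degX2 D1.
  have D4 : deg ((c - a - b) ^+ 2 - 4 * (a * b + 1)) = (2 * deg c)%N.
    rewrite degD_eq D3 //; first by apply: leq_ltn_trans D2 _; dlia.
  have n0 : (c - a - b) ^+ 2 - 4 * (a * b + 1) != 0 by apply: deg_gt0; dlia.
  rewrite -P mulf_eq0 negb_or in n0; case/andP: n0 => e0 n0; split=> //.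
  by rewrite -P degM // D in D4; dlia.
have sq_const p q : q ^+ 2 = p * p + 1 -> (0 < deg p)%N -> False.
  by move/(self_square K0) => ->.
have ae : a != e.
  apply/eqP => ae; have da : deg a = 0%N by apply: (self_square K0 (x := x1)); rewrite {2}ae.
  by rewrite -ae in dabe; dlia.
have be : b != e.
  by apply/eqP => be; apply: (sq_const b y1) => //; rewrite {2}be.
have dec : (deg e < deg c)%N by dlia.
have dae : (0 < deg a + deg e)%N by dlia.
have [|m [Z [X [u [v C]]]]] := chain_exists K0 J_reg Es Ez Ex a0 dc _ dcd Ja Jc Jd; try dlia.
have [|n [Z' [X' [u' [v' C']]]]] := chain_exists K0 J_reg Et Ez Ey b0 dc _ dcd Jb Jc Jd; try dlia.
have Rbace : reg b a c e by apply: reg_swap12.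
clear U.
pose near_a := exists p q f, [/\ z = p + c * q, p ^+ 2 = c * f + 1 & f = 0 \/ f = a].
have A : [\/ (exists s1 q, [/\ s1 ^+ 2 = a * c + 1,
     d = a * m.+1%:R ^+ 2 + 2 * m.+1%:R * s1 + c * q &
     deg d = (deg c + m.+1.-1 * (deg a + deg c))%N]) /\ near_a,
   [/\ deg a = 0%N, exists q, d = a * (m.+1%:R ^+ 2 + 1) + c * q & near_a] |
   [/\ u != 0, v != 0, (0 < deg a + deg u)%N, (deg v + deg a + deg u = deg c)%N &
      deg (2 * (a + c + u + 2 * a * c * u) - v) = (deg a + deg u + deg c)%N]].
  case: (chain_cases_lt K0 J_unit Es C a0 dc dac Ja) => [u0|[da a2 ua va]|H]; last by constructor 3.
    constructor 1; split; first exact: (form_zero Es C).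
    exact: (rep_zero Es C).
  constructor 2; split=> //; first exact: (form_self C).
  exact: (rep_self Es C).
have B : (exists t1 q, [/\ t1 ^+ 2 = b * c + 1,
     d = b * n.+1%:R ^+ 2 + 2 * n.+1%:R * t1 + c * q &
     deg d = (deg c + n.+1.-1 * (deg b + deg c))%N]) /\
     (exists p q f, [/\ z = p + c * q, p ^+ 2 = c * f + 1 & f = 0 \/ f = b]) \/
   [/\ u' != 0, v' != 0, (0 < deg b + deg u')%N, (deg v' + deg b + deg u' = deg c)%N &
      deg (2 * (b + c + u' + 2 * b * c * u') - v') = (deg b + deg u' + deg c)%N].
  case: (chain_cases_lt K0 J_unit Et C' b0 dc dbc Jb) => [u0|[] |H]; [left | dlia | by right].
  split; first exact: (form_zero Et C').
  exact: (rep_zero Et C').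
have [pa [qa [Eza Epa]]] := chain_rep Es C.
have [pb [qb [Ezb Epb]]] := chain_rep Et C'.
have duc := chu C; have duc' := chu C'.
have Fs1 (M : nat) s1 : s1 ^+ 2 = a * c + 1 -> (deg (a * M%:R ^+ 2 + 2 * M%:R * s1) < deg c)%N.
  by move=> Es1; have ds1 := deg_sqrt Es1 a0 c0; degbound.
have Ft1 (N : nat) t1 : t1 ^+ 2 = b * c + 1 -> (deg (b * N%:R ^+ 2 + 2 * N%:R * t1) < deg c)%N.
  by move=> Et1; have dt1 := deg_sqrt Et1 b0 c0; degbound.
have Fa (M : nat) : (deg (a * (M%:R ^+ 2 + 1)) < deg c)%N by degbound.
have Fbe (M : int) : (deg ((M + 1)%:~R * b - M%:~R * e + a * (M * (M + 1))%:~R) < deg c)%N.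
  by degbound.
have Fae (N : int) : (deg ((N + 1)%:~R * a - N%:~R * e + b * (N * (N + 1))%:~R) < deg c)%N.
  by degbound.
set fa := if odd m then u else v in Epa; set fb := if odd n then u' else v' in Epb.
have near_fa : near_a -> (deg fb < deg c)%N -> fb != 0 -> fb = a.
  case=> p [q [f [E1 E2 E3]]] dfb fb0.
  have <- : f = fb by apply: (rep_match E1 Ezb E2 Epb dc) => //; case: E3 => ->; rewrite ?deg0.
  case: E3 => // f0; case/eqP: fb0; rewrite -f0; symmetry.
  by apply: (rep_match E1 Ezb E2 Epb dc) => //; rewrite f0 deg0.
have dab' : (0 < deg b + deg a)%N by dlia.
have dbe' : (0 < deg b + deg e)%N by dlia.
case: B => [[B0 Bnear]|[u0' v0' h1' h2' h3']]; last first.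
  have dfb : (deg fb < deg c)%N by rewrite /fb; case: ifP; dlia.
  have fb0 : fb != 0 by rewrite /fb; case: ifP.
  have form_b : fb = a \/ fb = e -> u' = a /\ v' = e \/ u' = e /\ v' = a.
    move=> H; apply: (far_pair Et C' b0 dbc a0 e0 dac dec dab' Rbace h1' h2').
    by move: H; rewrite /fb; case: ifP => _ [] ->; [constructor 1|constructor 3|constructor 2|constructor 4].
  have FB H := form_far C' b0 dbc a0 e0 dac dec dab' dbe' ae h3' (form_b H).
  case: A => [[[s1 [q1 [Es1 E1 _]]] near]|[da [q1 E1] near]|[u0 v0 h1 h2 h3]].
  - have [N [q2 [N0 N1 E2 _ _]]] := FB (or_introl (near_fa near dfb fb0)).
    exfalso; apply: (no_match_zero_pair K0 J_unit Er1 Ex1 Ey1 cE a0 e0 db dab dbc dabe Ja Je (ltn0Sn m) N0 N1 Es1).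
    exact: (eq_mod_small E1 E2 (Fs1 _ _ Es1) (Fae N)).
  - have [N [q2 [N0 N1 E2 _ _]]] := FB (or_introl (near_fa near dfb fb0)).
    exfalso; apply: (no_match_self_pair K0 J_unit Er1 Ex1 Ey1 a0 e0 db dab dbc dabe Ja (ltn0Sn m) N0 N1 da).
    exact: (eq_mod_small E1 E2 (Fa _) (Fae N)).
  have dfa : (deg fa < deg c)%N by rewrite /fa; case: ifP; dlia.
  have fab : fa = fb by apply: (rep_match Eza Ezb Epa Epb dc).
  have Jfa : J fa by rewrite /fa; case: ifP => _; [exact: (chJu C) | exact: (chJv C)].
  have fa0 : fa != 0 by rewrite fab.
  have sqa : exists p, p ^+ 2 = a * fa + 1.
    rewrite /fa; case: ifP => _; first by exists X; exact: (chX C).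
    by exists (s * X - a * Z); exact: (chain_root_av Es C).
  have sqb : exists p, p ^+ 2 = b * fa + 1.
    rewrite fab /fb; case: ifP => _; first by exists X'; exact: (chX C').
    by exists (t * X' - b * Z'); exact: (chain_root_av Et C').
  have far_a : [\/ u = b, v = b, u = e | v = e] -> u = b /\ v = e \/ u = e /\ v = b.
    by apply: (far_pair Es C a0 dac b0 e0 dbc dec) => //; dlia.
  (* [fa = a] or [fa = b] would make that polynomial constant, its square plus 1 being a square. So
     [{a, b, c, fa}] is a quadruple, regular by induction. *)
  have fe : fa = e.
    have fa_a : fa != a.
      apply/eqP => faa; have da : deg a = 0%N.
        by case: sqa => p; rewrite faa => /(self_square K0).
      by move: faa; rewrite /fa; case: ifP => _ E; rewrite E in h1 h2; dlia.
    have fa_b : fa != b.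
      by apply/eqP => fb'; case: sqb => p; rewrite fb' => /sq_const; apply.
    have fa_c : fa != c by apply/eqP => fc; rewrite fc ltnn in dfa.
    have Q : quad J a b c fa.
      split=> //; last first.
        by split=> //; exists pa; rewrite Epa.
      - by split; [exists r | exists s | exists t].
      rewrite /= !inE !negb_or ab ![_ == fa]eq_sym fa_a fa_b fa_c /= !andbT.
      by apply/andP; split; apply: contraTneq (dbc) => E; rewrite -?E -leqNgt // E.
    have R := IH _ Q dfa.
    by apply: (reg_partner (reg_swap23 R) (reg_swap23 Rabce) a0 b0); rewrite // addnC.
  have Hu : u = b /\ v = e \/ u = e /\ v = b.
    by apply: far_a; move: fe; rewrite /fa; case: ifP => _ ->; [constructor 3|constructor 4].
  have dab2 : (0 < deg a + deg b)%N by rewrite addnC.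
  have [M [q1 [M0 M1 E1 D1 [oM M1m]]]] := form_far C a0 dac b0 e0 dbc dec dab2 dae be h3 Hu.
  have [N [q2 [N0 N1 E2 D2 [oN _]]]] := FB (or_intror (etrans (esym fab) fe)).
  have [M1' _] := match_pair_pair K0 J_unit Er1 Ex1 Ey1 a0 e0 db dab dbc dabe Ja M0 M1 N0 N1 ab
    (oM fe) (oN (etrans (esym fab) fe)) (etrans (esym D1) D2)
    (eq_mod_small E1 E2 (Fbe M) (Fae N)).
  have [m0 ub] := M1m M1'.
  by have := chain_reg1 Es C; rewrite -(ch0 C m0) ub; exact: reg_swap23.
case: B0 => t1 [q2 [Et1 E2 D2]].
case: A => [[[s1 [q1 [Es1 E1 D1]]] _]|[da [q1 E1] _]|[u0 v0 h1 h2 h3]]; exfalso.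
- apply: (no_match_zero_zero K0 a0 e0 db dab dbc dabe (ltn0Sn m) (ltn0Sn n) ab Es1 Et1).
    by rewrite -D1 -D2.
  exact: (eq_mod_small E1 E2 (Fs1 _ _ Es1) (Ft1 _ _ Et1)).
- apply: (no_match_self_zero K0 a0 e0 db dab dbc dabe (M := m.+1) (ltn0Sn n) Et1).
  exact: (eq_mod_small E1 E2 (Fa _) (Ft1 _ _ Et1)).
have dfa : (deg fa < deg c)%N by rewrite /fa; case: ifP; dlia.
have fab : fa = b.
  case: Bnear => p [q [f [G1 G2 G3]]].
  have F : fa = f by apply: (rep_match Eza G1 Epa G2 dc) => //; case: G3 => ->; rewrite ?deg0.
  case: G3 => G3; last by rewrite F.
  have : fa != 0 by rewrite /fa; case: ifP.
  by rewrite F G3 eqxx.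
have Hu : u = b /\ v = e \/ u = e /\ v = b.
  apply: (far_pair Es C a0 dac b0 e0 dbc dec) => //; first by rewrite addnC.
  by move: fab; rewrite /fa; case: ifP => _ ->; [constructor 1|constructor 2].
have dab2 : (0 < deg a + deg b)%N by rewrite addnC.
have [M [q1 [M0 M1 E1 _ _]]] := form_far C a0 dac b0 e0 dbc dec dab2 dae be h3 Hu.
apply: (no_match_pair_zero K0 J_unit Er1 Ex1 Ey1 cE a0 e0 db dab dbc dabe Ja (ltn0Sn n) Et1).
exact: (eq_mod_small E1 E2 (Fbe M) (Ft1 _ _ Et1)).
Qed.

End DominantThird.

(** * Reduction to increasing degrees *)

Section Sorting.
Variable K : fieldType.
Hypothesis K0 : [pchar K] =i pred0.
Variable J : {poly K} -> Prop.
Hypothesis J_reg : forall a c p q, J a -> J c -> J p -> reg a c p q -> J q.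
Hypothesis J_unit : forall a w : K, J a%:P -> w ^+ 2 = 2 * a * w + 1 -> a != 0 -> a ^+ 2 = -1.
Implicit Types a b c d : {poly K}.

Lemma quad_swap12 a b c d : quad J a b c d -> quad J b a c d.
Proof.
case=> [[a0 b0 c0 d0] U [[r Er] s t] [x y z] [Ja Jb Jc Jd]]; split=> //.
- by move: U; rewrite /= !inE !negb_or [b == a]eq_sym; do ![case: (_ != _) => //=].
- by split=> //; exists r; rewrite Er mulrC.
Qed.

Lemma quad_swap23 a b c d : quad J a b c d -> quad J a c b d.
Proof.
case=> [[a0 b0 c0 d0] U [r s [t Et]] [x y z] [Ja Jb Jc Jd]]; split=> //.
- by move: U; rewrite /= !inE !negb_or [c == b]eq_sym; do ![case: (_ != _) => //=].
- by split=> //; exists t; rewrite Et mulrC.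
Qed.

Lemma quad_swap34 a b c d : quad J a b c d -> quad J a b d c.
Proof.
case=> [[a0 b0 c0 d0] U [r s t] [x y [z Ez]] [Ja Jb Jc Jd]]; split=> //.
- by move: U; rewrite /= !inE !negb_or [d == c]eq_sym; do ![case: (_ != _) => //=].
- by split=> //; exists z; rewrite Ez mulrC.
Qed.

Lemma reg_quad_sorted a b c d : quad J a b c d -> (deg a <= deg b)%N -> (deg b <= deg c)%N ->
  (deg c <= deg d)%N -> (0 < deg d)%N ->
  (forall f, quad J a b c f -> (deg f < deg c)%N -> (0 < deg b)%N -> reg a b c f) -> reg a b c d.
Proof.
move=> Q dab dbc dcd dd IH.
have db : (0 < deg b)%N.
  rewrite lt0n; apply/eqP => db; have da : deg a = 0%N by dlia.
  case: Q => [[a0 b0 c0 d0] U _ [[x Ex] [y Ey] _] _].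
  by move: U; rewrite /= (two_consts K0 Ex Ey a0 b0 da db dd) !inE eqxx.
move: dbc; rewrite leq_eqVlt => /orP[/eqP dbc|dbc].
  exact: (reg_quad_equal_degrees K0 J_reg J_unit Q).
by apply: (reg_quad_dominant_third K0 J_reg J_unit Q) => // f Qf df; apply: IH.
Qed.

(** The induction hypothesis is applied to [(a, b, c, f)] with [deg f < deg c <= deg d], which
    lowers the sum of the degrees. *)
Lemma reg_quad a b c d : quad J a b c d -> (0 < deg a + deg b + deg c + deg d)%N -> reg a b c d.
Proof.
move: {2}_.+1 (ltnSn (deg a + deg b + deg c + deg d)%N) => n.
elim: n a b c d => // n IH a b c d.

(* Five comparisons sort four degrees; each exchange keeps the inequalities already obtained. *)
wlog dab : a b c d / (deg a <= deg b)%N => [W dn Q ds|].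
  have [h|h] := leqP (deg a) (deg b); first exact: W.
  by apply: reg_swap12; apply: W => //; try apply: quad_swap12 => //; dlia.
wlog dcd : a b c d dab / (deg c <= deg d)%N => [W dn Q ds|].
  have [h|h] := leqP (deg c) (deg d); first exact: W.
  by apply: reg_swap34; apply: W => //; try apply: quad_swap34 => //; dlia.
wlog dac : a b c d dab dcd / (deg a <= deg c)%N => [W dn Q ds|].
  have [h|h] := leqP (deg a) (deg c); first exact: W.
  apply: reg_swap23; apply: reg_swap12; apply: reg_swap34; apply: reg_swap23.
  apply: W => //; try by dlia.
  by apply: quad_swap23; apply: quad_swap34; apply: quad_swap12; apply: quad_swap23.
wlog dbd : a b c d dab dcd dac / (deg b <= deg d)%N => [W dn Q ds|].
  have [h|h] := leqP (deg b) (deg d); first exact: W.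
  apply: reg_swap23; apply: reg_swap34; apply: reg_swap23.
  apply: W => //; try by dlia.
  by apply: quad_swap23; apply: quad_swap34; apply: quad_swap23.
wlog dbc : a b c d dab dcd dac dbd / (deg b <= deg c)%N => [W dn Q ds|].
  have [h|h] := leqP (deg b) (deg c); first exact: W.
  by apply: reg_swap23; apply: W => //; try apply: quad_swap23 => //; dlia.
move=> dn Q ds; apply: (reg_quad_sorted Q) => //; first by dlia.
by move=> f Qf df db; apply: IH => //; dlia.
Qed.
End Sorting.

(** * Gaussian rationals *)

Local Notation gauss := (complex rat).

Lemma rat_integral (q : rat) : integralOver (intr : int -> gauss) (real_complex rat q) ->
  exists n : int, q = n%:~R.
Proof.
case=> p mp rp.
have rq : root (map_poly (intr : int -> rat) p) q.
  rewrite -(fmorph_root (real_complex rat)) -map_poly_comp.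
  rewrite (eq_map_poly (g := (intr : int -> gauss))) // => n /=.
  by rewrite rmorph_int.
have ra : root (map_poly (intr : int -> algC) p) (ratr q).
  rewrite -(eq_map_poly (f := (ratr : rat -> algC) \o (intr : int -> rat))).
    by rewrite map_poly_comp fmorph_root.
  by move=> n /=; rewrite ratr_int.
have /Cint_rat_Aint : ratr q \in Crat by apply: Crat_rat.
case/(_ _)/intrP => [|n qn].
  apply: (root_monic_Aint ra); first exact: monic_map.
  by apply/polyOverP => i; rewrite coef_map /= intr_int.
by exists n; apply: (@fmorph_inj _ _ (ratr : {rmorphism rat -> algC})); rewrite /= ratr_int -qn.
Qed.

Definition conj_gauss (w : gauss) : gauss := Complex (complex.Re w) (- complex.Im w).

Lemma conj_gauss_is_additive : additive conj_gauss.
Proof. by case=> [a b] [c d]; congr Complex => /=; rewrite opprD. Qed.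
Lemma conj_gauss_is_multiplicative : multiplicative conj_gauss.
Proof.
split; last by congr Complex; rewrite /= oppr0.
by case=> [a b] [c d]; congr Complex => /=; ring.
Qed.
HB.instance Definition _ := GRing.isAdditive.Build gauss gauss conj_gauss conj_gauss_is_additive.
HB.instance Definition _ := GRing.isMultiplicative.Build gauss gauss conj_gauss conj_gauss_is_multiplicative.

Local Notation integral := (integralOver (intr : int -> gauss)).

Lemma integral_intr (n : int) : integral n%:~R.
Proof. exact: integral_id. Qed.

Lemma integral_conj w : integral w -> integral (conj_gauss w).
Proof.
case=> p mp rp; exists p => //.
have -> : map_poly (intr : int -> gauss) p = map_poly conj_gauss (map_poly (intr : int -> gauss) p).
  by rewrite -map_poly_comp; apply: eq_map_poly => n /=; rewrite rmorph_int.
by rewrite fmorph_root.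
Qed.

Lemma integral_quadratic (S P w : gauss) : integral S -> integral P ->
  w ^+ 2 = S * w + P -> integral w.
Proof.
move=> iS iP E; apply: (@integral_root_monic _ _ _ w ('X^2 - (S *: 'X + P%:P))).
- rewrite monicE lead_coefDl ?lead_coefXn // size_polyN size_polyXn.
  by rewrite (leq_ltn_trans (size_polyD _ _)) // gtn_max ltnS (leq_trans (size_scale_leq _ _)) ?size_polyX // (leq_ltn_trans (size_polyC_leq1 _)).
- by rewrite rootE !hornerE E subrr.
apply/integral_poly => i; rewrite coefB coefD coefZ coefXn coefX coefC.
apply: integral_sub; first exact: integral_nat.
apply: integral_add; first by apply: integral_mul => //; exact: integral_nat.
by case: eqP => // _; exact: integral0.
Qed.

Lemma integral_i : integral (Complex 0 1).
Proof.
apply: (@integral_quadratic 0 (-1)); rewrite ?mul0r ?add0r.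
- exact: integral0.
- by apply: integral_opp; exact: integral1.
by congr Complex => /=; ring.
Qed.

Lemma sum_two_squares_eq4 (t s : int) : t * t + s * s = 4 ->
  (t * t = 4 /\ s = 0) \/ (t = 0 /\ s * s = 4).
Proof.
move=> E; have lo (x : int) : x * x <= 4 -> [\/ x = 0, x = 1 \/ x = -1 | x = 2 \/ x = -2].
  move=> h; have [h1 h2] : -2 <= x /\ x <= 2 by split; nia.
  have [|[|[|[|]]]] : x = 0 \/ x = 1 \/ x = -1 \/ x = 2 \/ x = -2 by lia.
  - by constructor 1.
  - by constructor 2; left.
  - by constructor 2; right.
  - by constructor 3; left.
  - by constructor 3; right.
have ht : t * t <= 4 by nia.
have hs : s * s <= 4 by nia.
case: (lo t ht) => [t0|[]t0|[]t0]; case: (lo s hs) => [s0|[]s0|[]s0]; subst; lia.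
Qed.

(** [w] is a unit with inverse [w - 2 a], so its norm is 1. As [2 Re w] and [2 Im w] are integers
    with squares summing to 4, [w^2] is 1 or -1; the first gives [a = 0], the second [a = w]. *)
Lemma gauss_unit (a w : gauss) : integral (2 * a) -> w ^+ 2 = 2 * a * w + 1 -> a != 0 -> a ^+ 2 = -1.
Proof.
move=> ia E a0.
have iw : integral w by apply: (integral_quadratic ia (integral1 _)).
have ic := integral_conj iw.
have i1 : integral (w - 2 * a) by apply: integral_sub.
have i1c := integral_conj i1.
have w1 : w * (w - 2 * a) = 1 by transitivity (w ^+ 2 - 2 * a * w); [ring | rewrite E; ring].
have norm (z : gauss) : z * conj_gauss z = real_complex rat (complex.Re z ^+ 2 + complex.Im z ^+ 2).
  by case: z => x y; congr Complex => /=; ring.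
have [k kE] : exists k : int, complex.Re w ^+ 2 + complex.Im w ^+ 2 = k%:~R.
  by apply: rat_integral; rewrite -norm; apply: integral_mul.
have [l lE] : exists l : int, complex.Re (w - 2 * a) ^+ 2 + complex.Im (w - 2 * a) ^+ 2 = l%:~R.
  by apply: rat_integral; rewrite -norm; apply: integral_mul.
have kl : k * l = 1.
  apply: (@intr_inj rat); rewrite rmorphM /= -kE -lE.
  apply: (fmorph_inj (real_complex rat)); rewrite rmorphM /= -!norm.
  transitivity ((w * (w - 2 * a)) * conj_gauss (w * (w - 2 * a))).
    by rewrite rmorphM; ring.
  by rewrite w1 rmorph1 mulr1.
have k0 : 0 <= k by rewrite -(ler_int rat) -kE addr_ge0 ?sqr_ge0.
have k1 : k = 1.
  by have /eqP := congr1 absz kl; rewrite abszM muln_eq1 => /andP[/eqP]; lia.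
have [t tE] : exists t : int, 2 * complex.Re w = t%:~R.
  apply: rat_integral; have -> : real_complex rat (2 * complex.Re w) = w + conj_gauss w.
    by case: (w) => x y; congr Complex => /=; ring.
  exact: integral_add.
have [s sE] : exists s : int, 2 * complex.Im w = s%:~R.
  apply: rat_integral; have -> : real_complex rat (2 * complex.Im w) = Complex 0 1 * (conj_gauss w - w).
    by case: (w) => x y; congr Complex => /=; ring.
  by apply: integral_mul; [exact: integral_i | apply: integral_sub].
have ts : t * t + s * s = 4.
  apply: (@intr_inj rat); rewrite rmorphD !rmorphM /= -tE -sE.
  transitivity (4 * (complex.Re w ^+ 2 + complex.Im w ^+ 2)); first by ring.
  by rewrite kE k1.
have w2 : w ^+ 2 = 1 \/ w ^+ 2 = -1.
  have [[t2 s0]|[t0 s2]] : (t * t = 4 /\ s = 0) \/ (t = 0 /\ s * s = 4).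
    exact: sum_two_squares_eq4.
    left; case: (w) tE sE => x y /= tE sE.
    have y0 : y = 0 by apply: (mulfI (_ : 2 != 0 :> rat)); rewrite // sE s0 mulr0.
    have x2 : x * x = 1.
      apply: (mulfI (_ : 4 != 0 :> rat)) => //; transitivity ((2 * x) * (2 * x)); first by ring.
      by rewrite tE -rmorphM /= t2.
    by rewrite y0; congr Complex => /=; rewrite ?x2; ring.
  right; case: (w) tE sE => x y /= tE sE.
  have x0 : x = 0 by apply: (mulfI (_ : 2 != 0 :> rat)); rewrite // tE t0 mulr0.
  have y2 : y * y = 1.
    apply: (mulfI (_ : 4 != 0 :> rat)) => //; transitivity ((2 * y) * (2 * y)); first by ring.
    by rewrite sE -rmorphM /= s2.
  by rewrite x0; congr Complex => /=; rewrite ?y2; ring.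
have w0 : w != 0 by apply: contraTneq (oner_neq0 gauss) => w0; rewrite -w1 w0 mul0r eqxx.
have two0 : 2 != 0 :> gauss by [].
case: w2 => w2.
  have /eqP : 2 * a * w = 0 by transitivity (2 * a * w + 1 - 1); [ring | rewrite -E w2; ring].
  by rewrite !mulf_eq0 (negPf two0) (negPf a0) (negPf w0).
have aw : a * w = -1.
  apply: (mulfI two0); transitivity (2 * a * w + 1 - 1); first by ring.
  by rewrite -E w2; ring.
have -> : a = w.
  by apply: (mulIf w0); rewrite aw -expr2 w2.
exact: w2.
Qed.

Lemma gauss_char0 : [pchar gauss] =i pred0.
Proof.
by apply/pcharf0P => n; rewrite -(rmorph_nat (real_complex rat)) fmorph_eq0 pnatr_eq0.
Qed.

(** Evaluation at 0 preserves [reg] and fixes constants; the factor 2 clears the denominator of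
    [i/2]. *)
Definition half_integral (p : {poly gauss}) : Prop := integral (2 * p.[0]).

(** In doubled values the relation is [(A + C - P - Q)^2 = (A C + 4)(P Q + 4)], monic in [Q]; [S]
    and [P] below are the coefficients of this quadratic. *)
Lemma half_integral_reg a c p q : half_integral a -> half_integral c -> half_integral p ->
  reg a c p q -> half_integral q.
Proof.
rewrite /half_integral => ia ic ip R.
have E : (a.[0] + c.[0] - p.[0] - q.[0]) ^+ 2 = 4 * (a.[0] * c.[0] + 1) * (p.[0] * q.[0] + 1).
  by have := congr1 (fun f : {poly gauss} => f.[0]) R; rewrite !hornerE.
have ii (n : int) : integral n%:~R := integral_intr n.
clear R; move: a.[0] c.[0] p.[0] q.[0] ia ic ip E => {}a {}c {}p {}q ia ic ip E.
pose S := 2%:~R * (2 * a + 2 * c - 2 * p) + (2 * a * (2 * c) + 4%:~R) * (2 * p).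
pose P := 4%:~R * (2 * a * (2 * c) + 4%:~R) - (2 * a + 2 * c - 2 * p) * (2 * a + 2 * c - 2 * p).
apply: (@integral_quadratic S P).
- apply: integral_add; first by apply: integral_mul => //; apply: integral_sub => //; exact: integral_add.
  by apply: integral_mul => //; apply: integral_add => //; apply: integral_mul.
- apply: integral_sub; last by apply: integral_mul; apply: integral_sub => //; exact: integral_add.
  by apply: integral_mul => //; apply: integral_add => //; apply: integral_mul.
transitivity (4 * (a + c - p - q) ^+ 2 - (2 * a + 2 * c - 2 * p) ^+ 2
   + 2 * (2 * a + 2 * c - 2 * p) * (2 * q)); first by ring.
by rewrite E /S /P; ring.
Qed.

Lemma half_integral_unit (a w : gauss) : half_integral a%:P -> w ^+ 2 = 2 * a * w + 1 ->
  a != 0 -> a ^+ 2 = -1.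
Proof. by rewrite /half_integral hornerC; exact: gauss_unit. Qed.

(** * Transfer from Z[X] to Q(i)[X] *)

Local Notation iota := (map_poly (intr : int -> gauss)).

Lemma intr_gauss_inj : injective (intr : int -> gauss).
Proof.
move=> m n; rewrite -!(rmorph_int (real_complex rat)).
by move/(fmorph_inj (real_complex rat))/intr_inj.
Qed.

Lemma iota_inj : injective iota.
Proof. by apply: map_inj_poly => //; exact: intr_gauss_inj. Qed.

Lemma iota_neq0 (p : {poly int}) : p != 0 -> iota p != 0.
Proof.
by move=> p0; apply: contraNneq p0 => E; apply/eqP/iota_inj; rewrite E map_poly0.
Qed.

Lemma deg_iota (p : {poly int}) : deg (iota p) = deg p.
Proof.
by rewrite /deg size_map_inj_poly //; exact: intr_gauss_inj.
Qed.

Definition twist (k : gauss) (p : {poly int}) : {poly gauss} := k%:P * iota p.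

Local Notation ihalf := (Complex 0 (1 / 2) : gauss).

Lemma ihalf_sqr : 4 * (ihalf * ihalf) = -1.
Proof. by apply/eqP; rewrite eq_complex. Qed.

Lemma twist_root k l e (n : int) (p q w : {poly int}) : e * e = k * l -> e * e * n%:~R = 1 ->
  w ^+ 2 = p * q + n%:~R -> (e%:P * iota w) ^+ 2 = twist k p * twist l q + 1.
Proof.
move=> ekl en Ew; have En : e%:P * e%:P * n%:~R = 1 :> {poly gauss}.
  by rewrite -[n%:~R](rmorph_int polyC) -!polyCM en polyC1.
rewrite /twist; transitivity (e%:P * e%:P * iota (w ^+ 2)); first by ring.
rewrite Ew; transitivity (e%:P * e%:P * iota p * iota q + e%:P * e%:P * n%:~R); first by ring.
by rewrite En -(polyCM e) ekl polyCM; ring.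
Qed.

Lemma twist_integral k p : integral (2 * k) -> half_integral (twist k p).
Proof.
move=> ik; rewrite /half_integral /twist hornerM hornerC horner_coef0 coef_map mulrA.
by apply: integral_mul => //; exact: integral_intr.
Qed.

Lemma sum_squares_eq0 (p q : {poly int}) : p ^+ 2 = - q ^+ 2 -> q = 0.
Proof.
move=> E; apply/eqP; rewrite -lead_coef_eq0.
have := congr1 lead_coef E; rewrite lead_coefN !expr2 !lead_coefM => /eqP.
by rewrite -addr_eq0 -!expr2 paddr_eq0 ?sqr_ge0 // !sqrf_eq0 => /andP[].
Qed.

(** The two squares are opposite, hence zero. So [d = - p] would force both other elements to have
    product 4 with [p], and to coincide. *)
Lemma opposite_roots (p q f w : {poly int}) : w ^+ 2 = p * q - 4 -> f ^+ 2 = p * (- q) + 4 -> p * q = 4.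
Proof.
move=> Ew Ef; have w0 : w = 0.
  by apply: (@sum_squares_eq0 f); rewrite Ew Ef; ring.
by transitivity (p * q - 4 + 4); [ring | rewrite -Ew w0; ring].
Qed.

(* Needed because [i a / 2] and [- i d / 2] coincide when [a = - d]. *)
Lemma Dm4_4_neq_opp (a b c d : {poly int}) : Dm4_4_quadruple a b c d ->
  [/\ a != - d, b != - d & c != - d].
Proof.
case=> U [a0 b0 c0 d0] [_ _ _ [[r Er] [s Es] [t Et]]] [[x Ex] [y Ey] [z Ez]].
move: U; rewrite /= !inE !negb_or => /and4P[/and3P[ab ac _] /andP[bc _] _ _].
have dE (p : {poly int}) : p = - d -> d = - p by move=> ->; rewrite opprK.
have key (p q f g u w1 w2 : {poly int}) : p != 0 -> q != f -> w1 ^+ 2 = q * p - 4 -> w2 ^+ 2 = f * p - 4 ->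
    g ^+ 2 = q * (- p) + 4 -> u ^+ 2 = f * (- p) + 4 -> False.
  move=> p0 /eqP qf E1 E2 E3 E4; apply: qf; apply: (mulIf p0).
  by rewrite (opposite_roots (esym (esym E1)) E3) (opposite_roots E2 E4).
split; apply/eqP => /dE E; rewrite E in Ex Ey Ez.
- by apply: (@key a b c y z r s) => //; rewrite -?Er -?Es; ring: Er Es.
- by apply: (@key b a c x z r t) => //; rewrite -?Er -?Et; ring: Er Et.
- by apply: (@key c a b x y s t).
Qed.

(** [regE] for the scaled quadruple, multiplied by -4 and cleared of [i/2] through [4 (i/2)^2 = -1].
    The products of [d] with [a], [b], [c] change side because [d] is scaled by [-i/2]. *)
Lemma Dm4_4_identity (a b c d : {poly int}) : Dm4_4_quadruple a b c d ->
  a ^+ 2 + b ^+ 2 + c ^+ 2 + d ^+ 2 + 2 * (a + b + c) * d + 16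
  = 2 * (a * b + a * c + b * c) + a * b * c * d.
Proof.
move=> Q; have [ad bd cd] := Dm4_4_neq_opp Q.
case: Q => U [a0 b0 c0 d0] [_ _ nc [[r Er] [s Es] [t Et]]] [[x Ex] [y Ey] [z Ez]].
move: U; rewrite /= !inE !negb_or => /and4P[/and3P[ab ac _] /andP[bc _] _ _].
have h0 : ihalf != 0 by rewrite eq_complex.
have hP0 : ihalf%:P != 0 :> {poly gauss} by rewrite polyC_eq0.
have tw0 p : p != 0 -> twist ihalf p != 0.
  by move=> p0; rewrite mulf_neq0 // iota_neq0.
have twN p : twist (- ihalf) p = twist ihalf (- p) by rewrite /twist polyCN; ring.
have tw_inj : injective (twist ihalf) by move=> p q /(mulfI hP0)/iota_inj.
have hh e : ihalf * ihalf * (-4)%:~R = 1 by transitivity (- (4 * (ihalf * ihalf))); [ring|rewrite ihalf_sqr; ring].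
have Q : quad half_integral (twist ihalf a) (twist ihalf b) (twist ihalf c) (twist (- ihalf) d).
  split.
  - by rewrite twN; split; rewrite tw0 // oppr_eq0.
  - by rewrite twN /= !inE !(inj_eq tw_inj) !negb_or ab ac bc ad bd cd.
  - by split; [exists (ihalf%:P * iota r)|exists (ihalf%:P * iota s)|exists (ihalf%:P * iota t)];
      apply: (@twist_root _ _ _ (-4)) => //; rewrite ?Er ?Es ?Et; ring.
  - have e2 : (1 / 2) * (1 / 2) = ihalf * - ihalf :> gauss by apply/eqP; rewrite eq_complex.
    have e4 : (1 / 2) * (1 / 2) * 4%:~R = 1 :> gauss by apply/eqP; rewrite eq_complex.
    by split; [exists ((1 / 2)%:P * iota x)|exists ((1 / 2)%:P * iota y)|exists ((1 / 2)%:P * iota z)];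
      apply: (@twist_root _ _ _ 4) => //; rewrite ?Ex ?Ey ?Ez; ring.
  have i1 : integral (2 * ihalf).
    by rewrite (_ : 2 * ihalf = Complex 0 1); [exact: integral_i | apply/eqP; rewrite eq_complex].
  by split; apply: twist_integral => //; rewrite mulrN; apply: integral_opp.
have dtw k p : k != 0 -> p != 0 -> deg (twist k p) = deg p.
  by move=> k0 p0; rewrite degM ?polyC_eq0 ?iota_neq0 // degC deg_iota.
have /regE R : reg (twist ihalf a) (twist ihalf b) (twist ihalf c) (twist (- ihalf) d).
  apply: (reg_quad gauss_char0 half_integral_reg half_integral_unit Q).
  rewrite !dtw ?oppr_eq0 // lt0n; apply/eqP => D; apply: nc.
  have cst p : deg p = 0%N -> is_constant p.
    by move=> dp; exists p`_0; apply: size1_polyC; move: dp; rewrite /deg; lia.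
  by split; apply: cst; dlia.
have E4 : 4 * (ihalf%:P * ihalf%:P) = -1 :> {poly gauss}.
  by rewrite -polyC_natr -!polyCM ihalf_sqr polyCN polyC1.
apply: iota_inj; apply/eqP; rewrite -subr_eq0; apply/eqP.
move: R E4; rewrite twN /twist; move: (ihalf%:P) => h R E4.
transitivity (-4 * ((h * iota a) ^+ 2 + (h * iota b) ^+ 2 + (h * iota c) ^+ 2 + (h * iota (- d)) ^+ 2
   - (2 * (h * iota a * (h * iota b) + h * iota a * (h * iota c) + h * iota a * (h * iota (- d))
      + h * iota b * (h * iota c) + h * iota b * (h * iota (- d)) + h * iota c * (h * iota (- d)))
    + 4 * (h * iota a) * (h * iota b) * (h * iota c) * (h * iota (- d)) + 4))
  + (4 * (h * h) + 1) * iota (a ^+ 2 + b ^+ 2 + c ^+ 2 + d ^+ 2 + 2 * (a + b + c) * d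
      - 2 * (a * b + a * c + b * c) - a * b * c * d)
  + (4 * (h * h) + 1) * (4 * (h * h)) * iota (a * b * c * d)); first by ring.
by rewrite E4 R; ring.
Qed.

Theorem corollary1p8 :
  (forall a b c d : {poly int}, Dm4_4_quadruple a b c d -> regular a b c d)
  /\
  (forall a b c r' s' t' d : {poly int},
     Dm4_triple a b c ->
     r' ^+ 2 = a * b - 4 -> s' ^+ 2 = a * c - 4 -> t' ^+ 2 = b * c - 4 ->
     Dm4_4_quadruple a b c d ->
     ZtoQ d = d_plus a b c r' s' t' \/ ZtoQ d = d_minus a b c r' s' t').
Proof.
have main (a b c r s t d : {poly int}) :
     r ^+ 2 = a * b - 4 -> s ^+ 2 = a * c - 4 -> t ^+ 2 = b * c - 4 ->
     Dm4_4_quadruple a b c d ->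
     ZtoQ d = d_plus a b c r s t \/ ZtoQ d = d_minus a b c r s t.
  move=> Er Es Et /Dm4_4_identity I.
  (* Completing the square in [d]: the discriminant is [(ab - 4)(ac - 4)(bc - 4)]. *)
  have /eqP : (2 * d + 2 * (a + b + c) - a * b * c) ^+ 2 = (r * s * t) ^+ 2.
    transitivity (4 * (a ^+ 2 + b ^+ 2 + c ^+ 2 + d ^+ 2 + 2 * (a + b + c) * d + 16)
      + 8 * (a * b + a * c + b * c) - 64 - 4 * a * b * c * (a + b + c) - 4 * a * b * c * d
      + (a * b * c) ^+ 2); first by ring.
    by rewrite I; ring: Er Es Et.
  have half (w : {poly int}) : 2 * d + 2 * (a + b + c) = a * b * c + w ->
      ZtoQ d = - ZtoQ (a + b + c) + (1 / 2 : rat) *: ZtoQ (a * b * c + w).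
    move=> <-; rewrite /ZtoQ -mul_polyC.
    have h2 : 2 * (1 / 2 : rat)%:P = 1 by rewrite -polyC_natr -polyCM -polyC1.
    transitivity (2 * (1 / 2 : rat)%:P * (map_poly intr d + map_poly intr (a + b + c))
      - map_poly intr (a + b + c)); first by rewrite h2; ring.
    by ring.
  rewrite eqf_sqr => /orP[] /eqP E; [left|right]; rewrite /d_plus /d_minus; apply: half.
    by rewrite -E; ring.
  by rewrite -[- _]E; ring.
split; last by move=> a b c r s t d _; exact: main.
move=> a b c d Q; have [_ _ [_ _ _ [[r Er] [s Es] [t Et]]] _] := Q.
by exists r, s, t; split=> //; apply: main.
Qed.
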